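(* Let $A$ be any (strictly unital) $A_\infty$-algebra over a field $\mathbb K$. Then for every $r\ge1$ the $r$-th power of the ghost ideal of $A$ coincides with the $r$-th step of the length filtration: $\mathcal G_A^r=F^r$; that is, $\mathcal G_A^r(M,N)=F^rH^*(\operatorname{Hom}_{A\text{-}\mathrm{Mod}_\infty}(M,N))$ for all left $A$-modules $M,N$.
   Context: **Modules.** $sA$ is the shift of $A$, $\mathcal BA=\bigoplus_{n\ge0}(sA)^{\otimes n}$ is the coaugmented bar coalgebra with deconcatenation comultiplication $\Delta$ and differential $b_A$, and $\mathcal B_nA=\bigoplus_{i\le n}(sA)^{\otimes i}$ (zero for $n<0$). A left $A$-module is a graded vector space $M$ with a degree $1$ map $\mu_M:\mathcal BA\otimes M\to M$, strictly unital, such that $b_M=(1\otimes\mu_M)(\Delta\otimes1)+b_A\otimes1$ satisfies $b_M^2=0$. The dg category $A\text{-}\mathrm{Mod}_\infty$ has $\operatorname{Hom}(M,N)$ the complex of graded maps $\varphi:\mathcal BA\otimes M\to N$ vanishing whenever some entry from $sA$ is the unit, with $d\varphi=\varphi b_M-(-1)^{|\varphi|}\mu_N(1\otimes\varphi)(\Delta\otimes1)$ and composition $\psi\varphi=\psi(1\otimes\varphi)(\Delta\otimes1)$. $H^*(A\text{-}\mathrm{Mod}_\infty)$ is the graded cohomology category. **Length filtration.** $\mathcal F^r\operatorname{Hom}(M,N)=\{\varphi:\varphi|_{\mathcal B_{r-1}A\otimes M}=0\}$, and $F^rH^*(\operatorname{Hom}(M,N))$ is the set of cohomology classes represented by cocycles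 in $\mathcal F^r\operatorname{Hom}(M,N)$. **Ghost ideal.** $\mathcal G_A$ is the ideal of $H^*(A\text{-}\mathrm{Mod}_\infty)$ of morphisms $f:M\to N$ inducing the zero map $H^*(\operatorname{Hom}(A,M))\to H^*(\operatorname{Hom}(A,N))$, where $A$ is viewed as a left module over itself. $\mathcal G_A^r$ is its $r$-th power, the ideal generated by (i.e. sums of) compositions of $r$ morphisms in $\mathcal G_A$. *)

(* Defs.v *)
From HB Require Import structures.
From mathcomp Require Import all_boot all_order all_algebra.

Set Implicit Arguments.
Unset Strict Implicit.
Unset Printing Implicit Defensive.

Import GRing.Theory.
Local Open Scope ring_scope.

(* A Z-graded vector space is the total space V = \bigoplus_i V^i, given with
   the projections [gpr i] onto its homogeneous components V^i. *)
Record gvect (K : fieldType) := Gvect {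
  gsort :> lmodType K;
  gpr : int -> gsort -> gsort;
  gpr_linear : forall i, linear (gpr i);
  gpr_proj : forall i j x, gpr i (gpr j x) = if i == j then gpr j x else 0;
  gpr_sum : forall x, exists s : seq int,
    uniq s && (x == \sum_(i <- s) gpr i x) }.

Section Graded.
Variables (K : fieldType) (V : gvect K).

(* x belongs to V^i *)
Definition gdeg (i : int) (x : V) : bool := gpr i x == x.

(* A finite set of degrees containing those of the components of x. *)
Definition gsupp (x : V) : seq int := xchoose (gpr_sum x).

(* The Koszul sign x |-> (-1)^(d |x|) x of moving x past something of degree d,
   extended linearly to inhomogeneous x. *)
Definition koszul (d : int) (x : V) : V :=
  \sum_(i <- gsupp x) ((-1 : K) ^ (d * i)) *: gpr i x.

(* The same sign for a tensor x_1 ... x_n. *)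
Definition kmap (d : int) (s : seq V) : seq V := map (koszul d) s.

End Graded.

Section Shift.
Variables (K : fieldType) (V : gvect K).

Fact gshift_proj (i j : int) (x : V) :
  gpr (i + 1) (gpr (j + 1) x) = if i == j then gpr (j + 1) x else 0.
Proof. by rewrite gpr_proj (inj_eq (addIr _)). Qed.

Fact gshift_sum (x : V) : exists s : seq int,
  uniq s && (x == \sum_(i <- s) gpr (i + 1) x).
Proof.
have [s /andP[us /eqP xE]] := gpr_sum x.
exists [seq i - 1 | i <- s]; rewrite (map_inj_uniq (addIr _)) us /=.
by rewrite big_map {1}xE; apply/eqP/eq_bigr => i _; rewrite subrK.
Qed.

(* The shift sV: same total space, (sV)^i = V^(i+1). *)
Definition gshift : gvect K :=
  @Gvect K V (fun i => gpr (i + 1)) (fun i => gpr_linear (i + 1))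
    gshift_proj gshift_sum.

End Shift.

(* By the universal property of the tensor product, a linear map out of
   BA \otimes M = \bigoplus_n (sA)^{\otimes n} \otimes M is a family of
   multilinear maps (sA)^n x M -> W, all gathered here in one function
   seq sA -> M -> W; likewise a linear map out of BA is a function seq sA -> W.
   A simple tensor x_1 ... x_n \otimes m is thus a pair of a list and m. *)
Section Multilinear.
Variables (K : fieldType) (V M : gvect K).

Definition multilin (W : lmodType K) (phi : seq V -> W) : Prop :=
  forall l r, linear (fun x => phi (l ++ x :: r)).

Definition multilin_mod (W : lmodType K) (phi : seq V -> M -> W) : Prop :=
  (forall s, linear (phi s)) /\ (forall m, multilin (phi^~ m)).

Definition homog (W : gvect K) (d : int) (phi : seq V -> W) : Prop :=
  forall (ds : seq int) (s : seq V),
    all2 (@gdeg K V) ds s -> gdeg (\sum_(i <- ds) i + d) (phi s).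

Definition homog_mod (W : gvect K) (d : int) (phi : seq V -> M -> W) : Prop :=
  forall (ds : seq int) (s : seq V) (i : int) (m : M),
    all2 (@gdeg K V) ds s -> gdeg i m ->
    gdeg (\sum_(j <- ds) j + i + d) (phi s m).

(* phi \circ b, where b is the coderivation of the tensor coalgebra of V with
   corestriction mu, b = \sum 1^{\otimes i} \otimes mu \otimes 1^{\otimes k}:
   b(x_1 ... x_n) is the sum over i <= j of
   +- x_1 ... x_i mu(x_{i+1} ... x_j) x_{j+1} ... x_n. *)
Definition bar_pull (mu : seq V -> V) (W : lmodType K) (phi : seq V -> W)
    (s : seq V) : W :=
  \sum_(i < (size s).+1) \sum_(j < (size s).+1 | (i <= j)%N)
    phi (kmap 1 (take i s) ++ mu (drop i (take j s)) :: drop j s).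

(* psi (1 \otimes phi) (\Delta \otimes 1), for phi of degree d. *)
Definition conv (d : int) (N : gvect K) (W : lmodType K)
    (psi : seq V -> N -> W) (phi : seq V -> M -> N) (s : seq V) (m : M) : W :=
  \sum_(i < (size s).+1) psi (kmap d (take i s)) (phi (drop i s) m).

(* phi \circ b_M, where b_M = (1 \otimes muM)(\Delta \otimes 1) + b \otimes 1
   and b is the coderivation with corestriction mu. *)
Definition mod_pull (mu : seq V -> V) (muM : seq V -> M -> M)
    (W : lmodType K) (phi : seq V -> M -> W) (s : seq V) (m : M) : W :=
  conv 1 phi muM s m + bar_pull mu (phi^~ m) s.

End Multilinear.

(* [amu] is the corestriction BA -> sA of the differential b_A.  A linear map
   is zero if and only if its composite with any linear map is, so [amu_sq]
   reads b_A^2 = 0.  For the strict unit, [amu] is related to the product by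
   mu_2(sa, sb) = (-1)^|a| s(ab). *)
Record ainfAlg (K : fieldType) := AinfAlg {
  acar :> gvect K;
  amu : seq (gshift acar) -> gshift acar;
  amu_nil : amu [::] = 0;
  amu_lin : multilin amu;
  amu_deg : homog 1 amu;
  amu_sq : forall (W : lmodType K) (phi : seq (gshift acar) -> W),
    multilin phi -> forall s, bar_pull amu (bar_pull amu phi) s = 0;
  aunit : gshift acar;
  aunit_deg : gdeg (-1) aunit;
  amu_unitl : forall x, amu [:: aunit; x] = x;
  amu_unitr : forall x, amu [:: x; aunit] = - koszul 1 x;
  amu_unit : forall l r, size (l ++ r) != 1%N -> amu (l ++ aunit :: r) = 0 }.

Section Modules.
Variables (K : fieldType) (A : ainfAlg K).

Notation sA := (gshift A).

Record ainfMod := AinfMod {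
  mcar :> gvect K;
  mmu : seq sA -> mcar -> mcar;
  mmu_lin : multilin_mod mmu;
  mmu_deg : homog_mod 1 mmu;
  mmu_sq : forall (W : lmodType K) (phi : seq sA -> mcar -> W),
    multilin_mod phi ->
    forall s m, mod_pull (@amu K A) mmu (mod_pull (@amu K A) mmu phi) s m = 0;
  mmu_unitl : forall m, mmu [:: aunit A] m = m;
  mmu_unit : forall l r m, size (l ++ r) != 0%N ->
    mmu (l ++ aunit A :: r) m = 0 }.

End Modules.

Section KoszulFacts.
Variables (K : fieldType) (V : gvect K).
Implicit Types (x y : V) (d i : int).

Lemma gpr0 i : gpr i (0 : V) = 0.
Proof.
have := gpr_linear i (-1) 0 (0 : V).
by rewrite scaler0 add0r scaleN1r addNr.
Qed.

Lemma gprD i x y : gpr i (x + y) = gpr i x + gpr i y.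
Proof. by have := gpr_linear i 1 x y; rewrite !scale1r. Qed.

Lemma gprZ i (a : K) x : gpr i (a *: x) = a *: gpr i x.
Proof. by have := gpr_linear i a x 0; rewrite gpr0 !addr0. Qed.

Lemma gsuppP x : uniq (gsupp x) /\ x = \sum_(i <- gsupp x) gpr i x.
Proof. by have /andP[? /eqP ?] := xchooseP (gpr_sum x). Qed.

Lemma gpr_big i (s : seq int) (c : int -> K) x : uniq s ->
  gpr i (\sum_(j <- s) c j *: gpr j x) = if i \in s then c i *: gpr i x else 0.
Proof.
elim: s => [|j s IHs] /=; first by rewrite big_nil gpr0.
case/andP=> js us; rewrite big_cons gprD gprZ IHs // gpr_proj inE.
case: eqVneq => [->|_] /=; first by rewrite (negPf js) addr0.
by rewrite scaler0 add0r.
Qed.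

Lemma gpr_notin i x : i \notin gsupp x -> gpr i x = 0.
Proof.
have [us xE] := gsuppP x => ni; rewrite xE.
under eq_bigr do rewrite -[gpr _ _]scale1r.
by rewrite gpr_big // (negPf ni).
Qed.

Lemma gpr_koszul i d x : gpr i (koszul d x) = ((-1 : K) ^ (d * i)) *: gpr i x.
Proof.
have [us _] := gsuppP x.
rewrite /koszul (gpr_big i (fun i => (-1) ^ (d * i))) //.
by case: ifPn => // /gpr_notin->; rewrite scaler0.
Qed.

Lemma gprP x y : (forall i, gpr i x = gpr i y) -> x = y.
Proof.
move=> xy; pose z := x - y.
have z0 i : gpr i z = 0 by rewrite /z gprD -scaleN1r gprZ scaleN1r xy subrr.
apply/eqP; rewrite -subr_eq0 -/z; have [_ ->] := gsuppP z.
by rewrite big1.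
Qed.

Lemma koszul_linear d : linear (koszul d : V -> V).
Proof.
move=> a x y; apply: gprP => i.
by rewrite !(gprD, gprZ, gpr_koszul) scalerDr !scalerA mulrC.
Qed.

Lemma sqr_sign d : ((-1 : K) ^ d) * (-1) ^ d = 1.
Proof. by rewrite -expfzMl mulrNN mul1r exp1rz. Qed.

Lemma sign_add d e : (-1 : K) ^ (d + e) = (-1) ^ d * (-1) ^ e.
Proof. by rewrite expfzDr // oppr_eq0 oner_eq0. Qed.

Lemma koszulK d : involutive (koszul d : V -> V).
Proof.
by move=> x; apply: gprP => i; rewrite !gpr_koszul scalerA sqr_sign scale1r.
Qed.

Lemma kmapK d : involutive (kmap d : seq V -> seq V).
Proof. by move=> s; rewrite /kmap -map_comp (eq_map (@koszulK d)) map_id. Qed.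

Lemma koszul_gdeg d i x : gdeg i x -> koszul d x = ((-1 : K) ^ (d * i)) *: x.
Proof.
move=> /eqP xE; apply: gprP => j; rewrite gpr_koszul gprZ -xE gpr_proj.
by case: eqVneq => [->|]; rewrite ?scaler0.
Qed.

Lemma gdegZ i (a : K) x : gdeg i x -> gdeg i (a *: x).
Proof. by move=> /eqP xE; rewrite /gdeg gprZ xE. Qed.

Lemma gdeg_gpr i x : gdeg i (gpr i x).
Proof. by rewrite /gdeg gpr_proj eqxx. Qed.

Lemma kmap_gdeg d ds (s : seq V) :
  all2 (@gdeg K V) ds s -> all2 (@gdeg K V) ds (kmap d s).
Proof.
elim: ds s => [|i ds IHds] [|x s] //= /andP[xi /IHds->].
by rewrite (koszul_gdeg _ xi) gdegZ.
Qed.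

End KoszulFacts.

Section LinearFacts.
Variables (K : fieldType) (U W : lmodType K) (f : U -> W).
Hypothesis f_lin : linear f.

Lemma lin0 : f 0 = 0.
Proof. by have := f_lin (-1) 0 0; rewrite scaler0 add0r scaleN1r addNr. Qed.

Lemma linD x y : f (x + y) = f x + f y.
Proof. by have := f_lin 1 x y; rewrite !scale1r. Qed.

Lemma linZ a x : f (a *: x) = a *: f x.
Proof. by have := f_lin a x 0; rewrite lin0 !addr0. Qed.

Lemma linN x : f (- x) = - f x.
Proof. by rewrite -scaleN1r linZ scaleN1r. Qed.

Lemma lin_sum I (s : seq I) (P : pred I) F :
  f (\sum_(i <- s | P i) F i) = \sum_(i <- s | P i) f (F i).
Proof. exact: (big_morph f linD lin0). Qed.

End LinearFacts.

Section BarFacts.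
Variables (K : fieldType) (V : gvect K).

Lemma kmap_homog (W : gvect K) (phi : seq V -> W) d ds l r :
  multilin phi -> all2 (@gdeg K V) ds l ->
  phi (kmap d l ++ r) = ((-1 : K) ^ (d * \sum_(i <- ds) i)) *: phi (l ++ r).
Proof.
move=> phi_lin; elim: ds l r phi phi_lin => [|i ds IHds] [|x l] r phi phi_lin //=.
  by rewrite big_nil mulr0 expr0z scale1r.
case/andP=> xi ll; rewrite (koszul_gdeg _ xi).
have := linZ (phi_lin [::] (kmap d l ++ r)) => /= ->.
have xlin : multilin (fun s => phi (x :: s)).
  by move=> l' r'; apply: (phi_lin (x :: l')).
have /= -> := IHds l r _ xlin ll.
by rewrite scalerA big_cons mulrDr sign_add.
Qed.

Lemma koszul_homog (W : gvect K) (phi : seq V -> W) d e s :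
  multilin phi -> homog e phi ->
  koszul d (phi s) = ((-1 : K) ^ (d * e)) *: phi (kmap d s).
Proof.
move=> phi_lin phi_deg.
suff H r : forall ds l, all2 (@gdeg K V) ds l ->
    koszul d (phi (l ++ r)) = ((-1 : K) ^ (d * e)) *: phi (kmap d (l ++ r)).
  exact: (H s [::] [::]).
elim: r => [|x r IHr] ds l dl.
  rewrite !cats0 (koszul_gdeg _ (phi_deg _ _ dl)).
  have := kmap_homog d [::] phi_lin dl; rewrite !cats0 => ->.
  by rewrite scalerA mulrDr sign_add mulrC.
have lin1 : linear (fun x => koszul d (phi (l ++ x :: r))).
  by move=> a u v /=; rewrite phi_lin koszul_linear.
have lin2 : linear (fun x => ((-1 : K) ^ (d * e)) *: phi (kmap d (l ++ x :: r))).
  move=> a u v /=; rewrite /kmap !map_cat /= koszul_linear phi_lin.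
  by rewrite scalerDr !scalerA mulrC.
have [_ ->] := gsuppP x.
rewrite (lin_sum lin1) (lin_sum lin2); apply: eq_bigr => i _.
rewrite -cat_rcons; apply: (IHr (rcons ds i)).
elim: ds l {lin1 lin2} dl => [|j ds IHds] [|y l] //=; first by rewrite gdeg_gpr.
by case/andP=> -> /IHds.
Qed.

Lemma eq_bar_pull (mu : seq V -> V) (W : lmodType K) (phi psi : seq V -> W) :
  phi =1 psi -> bar_pull mu phi =1 bar_pull mu psi.
Proof. by move=> e s; apply: eq_bigr => i _; apply: eq_bigr => j _. Qed.

Lemma bar_pullN (mu : seq V -> V) (W : lmodType K) (phi : seq V -> W) s :
  bar_pull mu (fun t => - phi t) s = - bar_pull mu phi s.
Proof.
by rewrite -sumrN; apply: eq_bigr => i _; rewrite -sumrN.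
Qed.

Lemma bar_pull_lin (mu : seq V -> V) (W : lmodType K) (phi : seq V -> W) :
  multilin mu -> multilin phi -> multilin (bar_pull mu phi).
Proof.
move=> mu_lin phi_lin l r a x y; rewrite /bar_pull !size_cat /=.
rewrite scaler_sumr -big_split; apply: eq_bigr => i _ /=.
rewrite scaler_sumr -big_split; apply: eq_bigr => j /= ij.
case: (ltnP (size l) i) => [li|il].
  have lj := leq_trans li ij.
  rewrite !take_cat !drop_cat !ltnNge (ltnW li) (ltnW lj) /=.
  rewrite -(subnSK li) -(subnSK lj) /= /kmap !map_cat /= koszul_linear.
  rewrite !drop_cat !ltnNge (ltnW li) /= -(subnSK li) /=.
  by rewrite -!catA !cat_cons phi_lin.
have takeE z : take i (l ++ z :: r) = take i l.
  by rewrite takel_cat.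
rewrite !takeE; case: (ltnP (size l) j) => [lj|jl].
  rewrite !take_cat !drop_cat !(ltnNge j) (ltnW lj) /= -(subnSK lj) /=.
  move: il; rewrite leq_eqVlt => /orP[/eqP il|il]; rewrite !drop_cat.
    by rewrite il ltnn subnn /=; have /= -> := mu_lin [::]; apply: phi_lin.
  by rewrite il mu_lin; apply: phi_lin.
rewrite !takel_cat //.
have dropE z : drop j (l ++ z :: r) = drop j l ++ z :: r.
  move: jl; rewrite drop_cat leq_eqVlt => /orP[/eqP->|->] //.
  by rewrite ltnn subnn drop0 drop_size.
by rewrite !dropE -!cat_cons !catA phi_lin.
Qed.

End BarFacts.

(* A as a left module over itself.  With b_A and b_M both of degree 1, the
   identification of b_A on BA \otimes sA with b_M on BA \otimes A via
   1 \otimes s gives muA(x \otimes a) = - (-1)^|x| s^{-1} mu(x \otimes sa). *)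
Section Regular.
Variables (K : fieldType) (A : ainfAlg K).

Notation sA := (gshift A).

Definition reg_mu (s : seq sA) (a : A) : A :=
  - amu (rcons (kmap 1 s) (a : sA)).

Lemma reg_lin : @multilin_mod K sA A A reg_mu.
Proof.
split=> [s a x y | m l r a x y]; rewrite /reg_mu.
  by rewrite -!cats1 amu_lin opprD scalerN.
rewrite /kmap !map_cat /= !rcons_cat /= koszul_linear.
by rewrite amu_lin opprD scalerN.
Qed.

Lemma reg_deg : @homog_mod K sA A A 1 reg_mu.
Proof.
move=> ds s i a dss ai.
have dsa : all2 (@gdeg K sA) (rcons ds (i - 1)) (rcons (kmap 1 s) (a : sA)).
  move: (kmap_gdeg 1 dss); move: (kmap 1 s) => {dss}s.
  elim: ds s => [|j ds IHds] [|y s] //=.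
    by move: ai; rewrite /gdeg /= subrK => ->.
  by case/andP=> -> /IHds.
have := amu_deg dsa; rewrite /gdeg /= -cats1 big_cat big_seq1 /= => /eqP amuE.
rewrite /reg_mu -scaleN1r gprZ; apply/eqP; congr (_ *: _).
by rewrite -{2}amuE; congr (gpr _ _); rewrite !addrA subrK.
Qed.

Lemma reg_unitl (a : A) : reg_mu [:: aunit A] a = a.
Proof.
rewrite /reg_mu /= (koszul_gdeg _ (aunit_deg A)) mul1r.
have := linZ (amu_lin (a := A) [::] [:: (a : sA)]) => /= ->.
by rewrite amu_unitl exprN1 invrN1 scaleN1r opprK.
Qed.

Lemma reg_unit l r (a : A) : size (l ++ r) != 0%N ->
  reg_mu (l ++ aunit A :: r) a = 0.
Proof.
move=> slr; rewrite /reg_mu /kmap map_cat /= rcons_cat /=.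
rewrite (koszul_gdeg _ (aunit_deg A)).
rewrite (linZ (amu_lin _ _)) amu_unit ?scaler0 ?oppr0 //.
by move: slr; rewrite !size_cat size_rcons !size_map addnS eqSS.
Qed.

(* Words in BA \otimes sA seen as words in BA. *)
Let flat (W : lmodType K) (phi : seq sA -> A -> W) (t : seq sA) : W :=
  if t is x :: u then phi (kmap 1 (belast x u)) (last x u) else 0.

Let flat_rcons (W : lmodType K) phi s a : @flat W phi (rcons s a) = phi (kmap 1 s) a.
Proof. by case: s => //= x s; rewrite belast_rcons last_rcons. Qed.

Let flat_lin (W : lmodType K) phi : multilin_mod phi -> multilin (@flat W phi).
Proof.
case=> phi_lin1 phi_lin2 l; case/lastP=> [|r z] a x y.
  by rewrite !cats1 !flat_rcons phi_lin1.
rewrite -!rcons_cons -!rcons_cat !flat_rcons /kmap !map_cat /= koszul_linear.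
exact: phi_lin2.
Qed.

Let flat_pull (W : lmodType K) (phi : seq sA -> A -> W) s a :
  multilin_mod phi ->
  bar_pull (@amu K A) (flat phi) (rcons s a)
    = - mod_pull (@amu K A) (M := A) reg_mu phi (kmap 1 s) a.
Proof.
case=> phi_lin phi_lin2; rewrite /bar_pull size_rcons.
under eq_bigr => i _ do rewrite big_mkcond big_ord_recr /= -big_mkcond /=.
rewrite big_split /= opprD addrC; congr (_ + _).
  rewrite big_ord_recr /= leqnn.
  rewrite [X in _ + X](_ : _ = 0) ?addr0; last first.
    rewrite !take_oversize ?drop_oversize ?size_rcons // amu_nil cats1.
    by rewrite flat_rcons (lin0 (phi_lin _)).
  rewrite /conv size_map -sumrN; apply: eq_bigr => i _.
  rewrite (ltnW (ltn_ord i)) (@drop_oversize _ (size s).+1) ?size_rcons //.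
  rewrite (@take_oversize _ (size s).+1) ?size_rcons // cats1.
  rewrite flat_rcons -(linN (phi_lin _)) /reg_mu opprK.
  have si : (i <= size s)%N by rewrite -ltnS.
  rewrite drop_rcons // -cats1 takel_cat //.
  by rewrite /kmap !map_take map_drop -/(kmap 1 (kmap 1 s)) kmapK.
rewrite big_ord_recr /= [X in _ + X]big1 ?addr0; last first.
  by move=> j; rewrite leqNgt ltn_ord.
rewrite /bar_pull size_map -sumrN; apply: eq_bigr => i _; rewrite -sumrN.
apply: eq_bigr => j ij.
have sj : (j <= size s)%N by rewrite -ltnS.
have si : (i <= size s)%N by rewrite -ltnS.
rewrite drop_rcons // -cats1 !takel_cat // -rcons_cons -rcons_cat flat_rcons.
rewrite /kmap map_cat /= -/(kmap 1 (kmap 1 (take i s))) kmapK.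
rewrite (koszul_homog 1 _ (@amu_lin K A) (@amu_deg K A)) mulr1 expr1z scaleN1r.
rewrite (linN (phi_lin2 a _ _)) /kmap !(map_drop, map_take).
by rewrite -/(kmap 1 s) -/(kmap 1 (kmap 1 s)) kmapK.
Qed.

Lemma reg_sq (W : lmodType K) (phi : seq sA -> A -> W) : multilin_mod phi ->
  forall s a, mod_pull (@amu K A) (M := A) reg_mu
                (mod_pull (@amu K A) (M := A) reg_mu phi) s a = 0.
Proof.
move=> phi_lin s a; set psi := mod_pull _ _ phi.
have flat_psi : flat psi =1 fun t => - bar_pull (@amu K A) (flat phi) t.
  case/lastP=> [|t b].
    rewrite /bar_pull big_ord1 big_mkcond big_ord1 /= amu_nil.
    by rewrite (lin0 (phi_lin.1 _)) oppr0.
  by rewrite flat_rcons flat_pull // opprK.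
have bl := bar_pull_lin (@amu_lin K A) (flat_lin phi_lin).
have psiE t b : psi t b = - bar_pull (@amu K A) (flat phi) (rcons (kmap 1 t) b).
  by rewrite flat_pull // opprK kmapK.
have psi_lin : multilin_mod psi.
  split=> [t c x y | m l r c x y]; rewrite !psiE.
    by rewrite -!cats1 bl opprD scalerN.
  rewrite /kmap !map_cat /= !rcons_cat /= koszul_linear.
  by rewrite bl opprD scalerN.
have := flat_pull (kmap 1 s) a psi_lin.
rewrite kmapK (eq_bar_pull _ flat_psi) bar_pullN amu_sq ?oppr0.
  by move/eqP; rewrite eq_sym oppr_eq0 => /eqP.
exact: flat_lin.
Qed.

Definition regular : ainfMod A :=
  AinfMod reg_lin reg_deg reg_sq reg_unitl reg_unit.

End Regular.

Section Category.
Variables (K : fieldType) (A : ainfAlg K).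
Implicit Types (L M N : ainfMod A) (d e : int) (r : nat).

Definition cochain M N := seq (gshift A) -> M -> N.

(* phi is an element of Hom(M, N) of degree d. *)
Definition is_hom M N d (phi : cochain M N) : Prop :=
  [/\ multilin_mod phi, homog_mod d phi
    & forall l t m, phi (l ++ aunit A :: t) m = 0].

Definition hom_diff M N d (phi : cochain M N) : cochain M N := fun s m =>
  mod_pull (@amu K A) (@mmu K A M) phi s m
    - ((-1 : K) ^ d) *: conv d (@mmu K A N) phi s m.

(* The composite psi phi, for phi of degree d. *)
Definition hom_comp L M N d (psi : cochain M N) (phi : cochain L M)
  : cochain L N := conv d psi phi.

Definition cocycle M N d (phi : cochain M N) : Prop :=
  is_hom d phi /\ forall s m, hom_diff d phi s m = 0.

Definition coboundary M N d (phi : cochain M N) : Prop :=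
  exists2 psi : cochain M N,
    is_hom (d - 1) psi & forall s m, phi s m = hom_diff (d - 1) psi s m.

(* A morphism of degree d of H^*(A-Mod) is a class of cocycles of degree d for
   this relation.  A set of such morphisms is given below by the predicate, on
   cocycles, of representing a class in that set. *)
Definition cohomologous M N d (phi psi : cochain M N) : Prop :=
  coboundary d (fun s m => phi s m - psi s m).

(* F^r H^d(Hom(M, N)) *)
Definition in_filtration r M N d (phi : cochain M N) : Prop :=
  cocycle d phi /\
  exists psi : cochain M N,
    [/\ cocycle d psi, forall s m, (size s < r)%N -> psi s m = 0
      & cohomologous d phi psi].

(* f is in the ghost ideal: f o - : H^*(Hom(A, M)) -> H^*(Hom(A, N)) is 0. *)
Definition ghost M N d (f : cochain M N) : Prop :=
  cocycle d f /\
  forall e (x : cochain (regular A) M), cocycle e x ->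
    coboundary (d + e) (hom_comp e f x).

(* Compositions of r >= 1 morphisms of the ghost ideal. *)
Inductive ghost_comp : nat -> forall M N, int -> cochain M N -> Prop :=
| GhostOne M N d (f : cochain M N) : ghost d f -> ghost_comp 1 d f
| GhostComp r L M N d e (f : cochain M N) (g : cochain L M) :
    ghost_comp r d f -> ghost e g ->
    ghost_comp r.+1 (d + e) (hom_comp e f g).

(* The r-th power of the ghost ideal: sums of compositions of r ghosts. *)
Definition ghost_power r M N d (f : cochain M N) : Prop :=
  cocycle d f /\
  exists (k : nat) (g : 'I_k -> cochain M N),
    (forall i, ghost_comp r d (g i)) /\
    cohomologous d f (fun s m => \sum_(i < k) g i s m).

End Category.

(* Main.v *)
From HB Require Import structures.
Require Import Defs.
From mathcomp Require Import all_boot all_order all_algebra.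
From mathcomp Require Import boolp classical_sets functions.
From mathcomp Require Import ring.

Set Implicit Arguments.
Unset Strict Implicit.
Unset Printing Implicit Defensive.

Import GRing.Theory.
Local Open Scope ring_scope.

(** Why the powers of the ghost ideal are the steps of the length filtration.

    The case r = 1.  The free module A represents cohomology: evaluation at the
    unit identifies H^*(Hom(A, M)) with H^*(M).  So a cocycle f : M -> N is a
    ghost exactly when its linear part f_0 : M -> N vanishes on cohomology.
    Concretely, a cocycle A -> N whose linear part kills the unit is a
    coboundary ([regular_nullhomotopy]), whence F^1 consists of ghosts; and a
    cycle m of M is the value at the unit of a cocycle A -> M ([point_cocycle]),
    whence a ghost vanishes on cohomology.  Over a field a chain map which
    vanishes on cohomology is null-homotopic ([chain_homotopy], which needs
    Zorn's lemma since no finiteness is assumed), and a homotopy h of f_0,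
    extended by zero to longer words, moves f into F^1.

    Ghost power in filtration.  Composition maps F^p x F^q to F^(p+q): a word
    of length less than p + q cannot be cut into pieces of length at least p
    and at least q.  The Leibniz rule [hom_diff_comp] passes this to classes.

    Filtration in ghost power.  The connecting map N -> Hom(A, N), which sends n
    to a |-> an, has as homotopy fibre a module C = N (+) Hom(sA, N)
    ([ghost_cover]).  The projection C -> N is a ghost: if (n, phi) is a cycle,
    then n is up to sign the boundary of phi(1).  A cocycle f in F^(r+1) factors
    strictly through it: the lift sends (s, m) to the pair of f(s, m) and
    a |-> +- f(a s, m), and it is a cocycle because f vanishes on the empty
    word.  One letter has been spent, so the lift lies in F^r, and induction on
    r writes f as a composition of r + 1 ghosts ([filtration_ghost_comp]).

    Every identity between words is reduced to formal properties of the sum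
    [cut F s] over the splittings s = l r, the deconcatenation coproduct. *)

(** * Deconcatenation *)

Section Cut.
Variable T : Type.

Definition cut (W : nmodType) (F : seq T -> seq T -> W) (s : seq T) : W :=
  \sum_(i < (size s).+1) F (take i s) (drop i s).

Lemma cut_nil (W : nmodType) (F : seq T -> seq T -> W) : cut F [::] = F [::] [::].
Proof. exact: big_ord1. Qed.

Lemma cut_cons (W : nmodType) (F : seq T -> seq T -> W) x s :
  cut F (x :: s) = F [::] (x :: s) + cut (fun l => F (x :: l)) s.
Proof. by rewrite /cut big_ord_recl. Qed.

Lemma eq_cut (W : nmodType) (F G : seq T -> seq T -> W) s :
  (forall l r, l ++ r = s -> F l r = G l r) -> cut F s = cut G s.
Proof. by move=> FG; apply: eq_bigr => i _; apply: FG; apply: cat_take_drop. Qed.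

Lemma cut0 (W : nmodType) (F : seq T -> seq T -> W) s :
  (forall l r, l ++ r = s -> F l r = 0) -> cut F s = 0.
Proof. by move=> F0; apply: big1 => i _; apply: F0; apply: cat_take_drop. Qed.

Lemma cut_first (W : nmodType) (F : seq T -> seq T -> W) s :
  (forall x l r, F (x :: l) r = 0) -> cut F s = F [::] s.
Proof.
by move=> F0; case: s => [|x s]; rewrite ?cut_nil // cut_cons cut0 ?addr0.
Qed.

Lemma cut_last (W : nmodType) (F : seq T -> seq T -> W) s :
  (forall l r, (0 < size r)%N -> F l r = 0) -> cut F s = F s [::].
Proof.
move=> F0; rewrite /cut big_ord_recr /= take_size drop_size big1 ?add0r // => i _.
by apply: F0; rewrite size_drop subn_gt0.
Qed.

Lemma cutD (W : nmodType) (F G : seq T -> seq T -> W) s :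
  cut (fun l r => F l r + G l r) s = cut F s + cut G s.
Proof. exact: big_split. Qed.

Lemma cut_lin (K : fieldType) (U W : lmodType K) (f : U -> W) F s :
  linear f -> f (cut F s) = cut (fun l r => f (F l r)) s.
Proof. by move=> fL; rewrite /cut (lin_sum fL). Qed.

Lemma cut_scale (K : fieldType) (W : lmodType K) (c : K) F s :
  c *: cut F s = cut (fun l r => c *: F l r : W) s.
Proof. exact: scaler_sumr. Qed.

Lemma cutN (W : zmodType) (F : seq T -> seq T -> W) s :
  cut (fun l r => - F l r) s = - cut F s.
Proof. exact: sumrN. Qed.

(** The letter x lies in exactly one of the two pieces. *)
Lemma cut_cat (W : nmodType) (F : seq T -> seq T -> W) l x r :
  cut F (l ++ x :: r) =
    cut (fun p q => F p (q ++ x :: r)) l + cut (fun p => F (l ++ x :: p)) r.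
Proof.
elim: l F => [|y l IHl] F /=; first by rewrite cut_cons cut_nil.
by rewrite !cut_cons IHl addrA.
Qed.

Lemma cut_rcons (W : nmodType) (F : seq T -> seq T -> W) s x :
  cut F (rcons s x) = cut (fun l r => F l (rcons r x)) s + F (rcons s x) [::].
Proof.
rewrite -cats1 cut_cat cut_nil; congr (_ + _).
by apply: eq_cut => l r _; rewrite cats1.
Qed.

Lemma cut_exchange (W : nmodType) (F : seq T -> seq T -> seq T -> seq T -> W) s t :
  cut (fun l r => cut (F l r) t) s = cut (fun u v => cut (fun l r => F l r u v) s) t.
Proof. exact: exchange_big. Qed.

(** Coassociativity: both sides sum over the splittings of s in three. *)
Lemma cut_coassoc (W : nmodType) (F : seq T -> seq T -> seq T -> W) s :
  cut (fun l r => cut (F l) r) s = cut (fun l r => cut (fun u v => F u v r) l) s.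
Proof.
elim: s F => [|x s IHs] F; first by rewrite !cut_nil.
rewrite !cut_cons cut_nil IHs -addrA; congr (_ + _).
by rewrite -cutD; apply: eq_cut => l r _; rewrite cut_cons.
Qed.

Lemma cut_map (W : nmodType) (F : seq T -> seq T -> W) g s :
  cut F (map g s) = cut (fun l r => F (map g l) (map g r)) s.
Proof.
by rewrite /cut size_map; apply: eq_bigr => i _; rewrite map_take map_drop.
Qed.

End Cut.

(** * Composition and the bar coderivation *)

Section CutBar.
Variables (K : fieldType) (V : gvect K).

Lemma koszulD d e (x : V) : koszul d (koszul e x) = koszul (d + e) x.
Proof.
by apply: gprP => i; rewrite !gpr_koszul scalerA mulrDl sign_add.
Qed.

Lemma koszul_id (x : V) : koszul 0 x = x.
Proof. by apply: gprP => i; rewrite gpr_koszul mul0r expr0z scale1r. Qed.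

Lemma kmapD d e (s : seq V) : kmap d (kmap e s) = kmap (d + e) s.
Proof. by rewrite /kmap -map_comp; apply: eq_map => x; apply: koszulD. Qed.

Lemma kmap_id (s : seq V) : kmap 0 s = s.
Proof. by rewrite /kmap (eq_map koszul_id) map_id. Qed.

Lemma kmap_cat d (s t : seq V) : kmap d (s ++ t) = kmap d s ++ kmap d t.
Proof. exact: map_cat. Qed.

(** The bar coderivation as a sum over the splittings of s in three, of which
    the middle piece is the argument of mu. *)
Lemma bar_pullE (mu : seq V -> V) (W : lmodType K) (phi : seq V -> W) s :
  bar_pull mu phi s =
    cut (fun l r => cut (fun u v => phi (kmap 1 l ++ mu u :: v)) r) s.
Proof.
rewrite /bar_pull /cut; apply: eq_bigr => i _.
rewrite -(big_geq_mkord _ _ xpredT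
  (fun j => phi (kmap 1 (take i s) ++ mu (drop i (take j s)) :: drop j s))).
rewrite -{1}[nat_of_ord i]add0n big_addn size_drop subSn; last by rewrite -ltnS.
rewrite big_mkord; apply: eq_bigr => j _.
by rewrite take_drop drop_drop.
Qed.

Lemma convE (M N : gvect K) (W : lmodType K) d (psi : seq V -> N -> W) phi s (m : M) :
  conv d psi phi s m = cut (fun l r => psi (kmap d l) (phi r m)) s.
Proof. by []. Qed.

(** The signs agree because the Koszul sign of a composite is the product of
    the two Koszul signs. *)
Lemma conv_assoc (L M N : gvect K) (W : lmodType K) d e
    (chi : seq V -> N -> W) (psi : seq V -> M -> N) (phi : seq V -> L -> M) s m :
  (forall t, linear (chi t)) ->
  conv (e + d) chi (conv d psi phi) s m = conv d (conv e chi psi) phi s m.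
Proof.
move=> chiL; rewrite !convE.
under eq_cut => l r _ do rewrite convE (cut_lin _ _ (chiL _)).
rewrite cut_coassoc; apply: eq_cut => l r _; rewrite convE /kmap cut_map.
by apply: eq_cut => u v _; rewrite -!/(kmap _ _) kmapD.
Qed.

(** Since b is a coderivation, the block to which mu is applied falls either in
    the piece read by phi or in the one read by psi.  In the first case b has
    moved past psi's piece, in the second mu has moved past phi, of degree d. *)
Lemma bar_conv (M N : gvect K) (W : lmodType K) d mu
    (psi : seq V -> N -> W) (phi : seq V -> M -> N) s m :
  multilin mu -> homog 1 mu -> multilin_mod psi ->
  bar_pull mu ((conv d psi phi)^~ m) s =
    conv (1 + d) psi (fun t m => bar_pull mu (phi^~ m) t) s m +
    ((-1 : K) ^ d) *: conv d (fun t n => bar_pull mu (psi^~ n) t) phi s m.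
Proof.
move=> muL muH [psiL psiL'].
have kmapC t : kmap d (kmap 1 t) = kmap (1 + d) t :> seq V by rewrite kmapD addrC.
rewrite bar_pullE.
transitivity (cut (fun l r => cut (fun p q => cut (fun u v =>
      psi (kmap (1 + d) p) (phi (kmap 1 q ++ mu u :: v) m)) r) l) s
    + cut (fun l r => cut (fun u v => cut (fun p q =>
      psi (kmap d (kmap 1 l ++ mu u :: p)) (phi q m)) v) r) s).
  (* cut the word l, mu u, v before or after the letter mu u *)
  rewrite -cutD; apply: eq_cut => l r _; rewrite cut_exchange -cutD.
  apply: eq_cut => u v _; rewrite convE cut_cat /kmap cut_map -!/(kmap _ _).
  by congr (_ + _); apply: eq_cut => p q _; rewrite -!/(kmap _ _) kmapC.
congr (_ + _).
  rewrite -cut_coassoc convE; apply: eq_cut => l r _.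
  rewrite bar_pullE (cut_lin _ _ (psiL _)); apply: eq_cut => p q _.
  by rewrite (cut_lin _ _ (psiL _)).
under eq_cut => l r _ do rewrite cut_coassoc.
rewrite cut_coassoc convE cut_scale; apply: eq_cut => l r _.
rewrite bar_pullE /kmap cut_map cut_scale; apply: eq_cut => p q _.
rewrite cut_map cut_scale; apply: eq_cut => u v _; rewrite -!/(kmap _ _).
rewrite !kmap_cat kmapC kmapD /= (koszul_homog d _ muL muH) mulr1.
exact: (linZ (psiL' (phi r m) (kmap (1 + d) p) (kmap d v))).
Qed.

End CutBar.

Section ConvFacts.
Variables (K : fieldType) (V : gvect K).
Implicit Types (L M N : gvect K) (W : lmodType K).

Lemma sign_parity (d e : int) : (-1 : K) ^ (d + (e + e)) = (-1) ^ d.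
Proof. by rewrite !sign_add sqr_sign mulr1. Qed.

Lemma koszul_parity d e (x : V) : koszul (d + (e + e)) x = koszul d x.
Proof. by apply: gprP => i; rewrite !gpr_koszul !mulrDl sign_parity. Qed.

Lemma kmap_parity d e (s : seq V) : kmap (d + (e + e)) s = kmap d s.
Proof. exact: eq_map (koszul_parity d e) s. Qed.

Lemma convDl M N W d (p q : seq V -> N -> W) (phi : seq V -> M -> N) s m :
  conv d (fun t n => p t n + q t n) phi s m = conv d p phi s m + conv d q phi s m.
Proof. by rewrite !convE -cutD. Qed.

Lemma convZl M N W d c (p : seq V -> N -> W) (phi : seq V -> M -> N) s m :
  conv d (fun t n => c *: p t n) phi s m = c *: conv d p phi s m.
Proof. by rewrite !convE cut_scale. Qed.

Lemma convNl M N W d (p : seq V -> N -> W) (phi : seq V -> M -> N) s m :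
  conv d (fun t n => - p t n) phi s m = - conv d p phi s m.
Proof. by rewrite !convE -cutN. Qed.

Lemma convDr M N W d (psi : seq V -> N -> W) (p q : seq V -> M -> N) s m :
  (forall t, linear (psi t)) ->
  conv d psi (fun t m => p t m + q t m) s m = conv d psi p s m + conv d psi q s m.
Proof.
move=> psiL; rewrite !convE -cutD; apply: eq_cut => l r _.
exact: linD (psiL _) _ _.
Qed.

Lemma convZr M N W d c (psi : seq V -> N -> W) (p : seq V -> M -> N) s m :
  (forall t, linear (psi t)) ->
  conv d psi (fun t m => c *: p t m) s m = c *: conv d psi p s m.
Proof.
move=> psiL; rewrite !convE cut_scale; apply: eq_cut => l r _.
exact: linZ (psiL _) _ _.
Qed.

Lemma eq_conv M N W d (psi psi' : seq V -> N -> W) (p p' : seq V -> M -> N) s m :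
  (forall t n, psi t n = psi' t n) -> (forall t m, p t m = p' t m) ->
  conv d psi p s m = conv d psi' p' s m.
Proof. by move=> e e'; apply: eq_bigr => i _; rewrite e e'. Qed.

Lemma multilin_conv M N W d (psi : seq V -> N -> W) (phi : seq V -> M -> N) :
  multilin_mod psi -> multilin_mod phi -> multilin_mod (conv d psi phi).
Proof.
move=> [psiL psiL'] [phiL phiL']; split=> [s a x y | m l r a x y].
  rewrite !convE cut_scale -cutD; apply: eq_cut => p q _.
  by rewrite phiL psiL.
rewrite !convE !cut_cat scalerDr addrACA; congr (_ + _).
  rewrite cut_scale -cutD; apply: eq_cut => p q _.
  by rewrite phiL' psiL.
rewrite cut_scale -cutD; apply: eq_cut => p q _.
by rewrite !kmap_cat /= koszul_linear psiL'.
Qed.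

Lemma multilin_bar M W mu (phi : seq V -> M -> W) :
  multilin mu -> multilin_mod phi ->
  multilin_mod (fun s m => bar_pull mu (phi^~ m) s).
Proof.
move=> muL [phiL phiL']; split=> [s a x y | m]; last exact: bar_pull_lin.
rewrite !bar_pullE cut_scale -cutD; apply: eq_cut => l r _.
rewrite cut_scale -cutD; apply: eq_cut => u v _; exact: phiL.
Qed.

Lemma gdeg_sum (W : gvect K) k I (r : seq I) (F : I -> W) :
  (forall i, gdeg k (F i)) -> gdeg k (\sum_(i <- r) F i).
Proof.
move=> kF; elim: r => [|i r IHr]; rewrite /gdeg ?big_nil ?gpr0 //.
by rewrite big_cons gprD (eqP (kF i)) (eqP IHr).
Qed.

Lemma all2_take_drop (ds : seq int) (s : seq V) i :
  all2 (@gdeg K V) ds s ->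
  all2 (@gdeg K V) (take i ds) (take i s) && all2 (@gdeg K V) (drop i ds) (drop i s).
Proof.
by elim: ds s i => [|e ds IHds] [|x s] [|i] //= /andP[-> /(IHds _ i)].
Qed.

Lemma homog_conv M N (W : gvect K) d e
    (psi : seq V -> N -> W) (phi : seq V -> M -> N) :
  homog_mod e psi -> homog_mod d phi -> homog_mod (d + e) (conv d psi phi).
Proof.
move=> psiH phiH ds s i m dss im; apply: gdeg_sum => k.
have /andP[ht hd] := all2_take_drop k dss.
have := psiH _ _ _ _ (kmap_gdeg d ht) (phiH _ _ _ _ hd im).
by rewrite -[in \sum_(j <- ds) _](cat_take_drop k ds) big_cat /= !addrA.
Qed.

End ConvFacts.

(** * The square-zero relations *)

Section ModPull.
Variables (K : fieldType) (A : ainfAlg K).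
Notation sA := (gshift A).
Notation mu := (@amu K A).

Lemma bar_pull_cons (W : lmodType K) (phi : seq sA -> W) x s : multilin phi ->
  bar_pull mu phi (x :: s) =
    cut (fun u v => phi (mu (x :: u) :: v)) s
    + bar_pull mu (fun t => phi (koszul 1 x :: t)) s.
Proof.
move=> phiL; rewrite !bar_pullE !cut_cons /= amu_nil.
by rewrite (lin0 (phiL [::] (x :: s))) add0r.
Qed.

Lemma mod_pull_nil (M : gvect K) (W : lmodType K) (nu : seq sA -> M -> M)
    (phi : seq sA -> M -> W) m : multilin_mod phi ->
  mod_pull mu nu phi [::] m = phi [::] (nu [::] m).
Proof.
move=> [_ phi2]; rewrite /mod_pull convE bar_pullE !cut_nil amu_nil.
by rewrite (lin0 (phi2 _ _ _)) addr0.
Qed.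

Lemma mod_pull_cons (M : gvect K) (W : lmodType K) (nu : seq sA -> M -> M)
    (phi : seq sA -> M -> W) x s m : multilin_mod phi ->
  mod_pull mu nu phi (x :: s) m =
    phi [::] (nu (x :: s) m) + cut (fun u v => phi (mu (x :: u) :: v) m) s
    + mod_pull mu nu (fun t => phi (koszul 1 x :: t)) s m.
Proof.
move=> [_ phi2]; rewrite /mod_pull bar_pull_cons // !convE cut_cons.
by rewrite addrACA.
Qed.

Lemma mod_pull_comp (M : gvect K) (W W' : lmodType K) (g : W -> W')
    (nu : seq sA -> M -> M) (phi : seq sA -> M -> W) s m : linear g ->
  g (mod_pull mu nu phi s m) = mod_pull mu nu (fun t m => g (phi t m)) s m.
Proof.
move=> gL; rewrite /mod_pull (linD gL) !convE !bar_pullE !(cut_lin _ _ gL).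
by congr (_ + _); apply: eq_cut => l r _; rewrite (cut_lin _ _ gL).
Qed.

Lemma mod_pullD (M : gvect K) (W : lmodType K) (nu : seq sA -> M -> M)
    (p q : seq sA -> M -> W) s m :
  mod_pull mu nu (fun t m => p t m + q t m) s m =
    mod_pull mu nu p s m + mod_pull mu nu q s m.
Proof.
rewrite /mod_pull convDl !bar_pullE addrACA; congr (_ + _).
by rewrite -cutD; apply: eq_cut => l r _; rewrite -cutD.
Qed.

Lemma mod_pullN (M : gvect K) (W : lmodType K) (nu : seq sA -> M -> M)
    (p : seq sA -> M -> W) s m :
  mod_pull mu nu (fun t m => - p t m) s m = - mod_pull mu nu p s m.
Proof. by rewrite /mod_pull convNl bar_pullN opprD. Qed.

Lemma mod_pullZ (M : gvect K) (W : lmodType K) (nu : seq sA -> M -> M) c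
    (p : seq sA -> M -> W) s m :
  mod_pull mu nu (fun t m => c *: p t m) s m = c *: mod_pull mu nu p s m.
Proof.
rewrite /mod_pull convZl !bar_pullE scalerDr; congr (_ + _).
by rewrite cut_scale; apply: eq_cut => l r _; rewrite cut_scale.
Qed.

(** The action part associates with psi; only the bar part meets psi. *)
Lemma mod_pull_conv (M N : gvect K) (W : lmodType K) d
    (nu : seq sA -> M -> M) (psi : seq sA -> N -> W) (phi : seq sA -> M -> N) s m :
  multilin_mod psi ->
  mod_pull mu nu (conv d psi phi) s m =
    conv (d + 1) psi (mod_pull mu nu phi) s m
    + ((-1 : K) ^ d) *: conv d (fun t n => bar_pull mu (psi^~ n) t) phi s m.
Proof.
move=> psiL; have psi1 := psiL.1; rewrite /mod_pull bar_conv ?convDr //.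
- by rewrite -conv_assoc // addrA [1 + d]addrC.
- exact: amu_lin.
- exact: amu_deg.
Qed.

(** The two mixed terms cancel and b_A^2 = 0, so b_M^2 is determined by its
    corestriction to M: it suffices to check one relation, for phi = nu. *)
Lemma mod_pull_sq (M : gvect K) (W : lmodType K) (nu : seq sA -> M -> M)
    (phi : seq sA -> M -> W) s m :
  multilin_mod phi ->
  mod_pull mu nu (mod_pull mu nu phi) s m = conv 2 phi (mod_pull mu nu nu) s m.
Proof.
move=> phiL; have [_ phi2] := phiL.
have -> : mod_pull mu nu (mod_pull mu nu phi) s m =
    mod_pull mu nu (conv 1 phi nu) s m
    + mod_pull mu nu (fun t m => bar_pull mu (phi^~ m) t) s m.
  by rewrite -mod_pullD.
rewrite mod_pull_conv // expr1z scaleN1r [X in _ + X]/mod_pull.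
by rewrite (amu_sq (phi2 m)) addr0 subrK.
Qed.

(** The A-infinity relations of M in corestricted form, read off b_M^2 = 0 by
    composing with the projection of BA (x) M onto M. *)
Lemma mmu_mod_pull (M : ainfMod A) s m :
  mod_pull mu (@mmu K A M) (@mmu K A M) s m = 0.
Proof.
pose eps (t : seq sA) (x : M) : M := if t is [::] then x else 0.
have epsL : multilin_mod eps.
  by split=> [[|x t] a u v | n [|y l] r a u v] //=; rewrite scaler0 addr0.
by rewrite -(mmu_sq epsL s m) mod_pull_sq // convE cut_first.
Qed.

(** The A-infinity relations of A, read off b_A^2 = 0 by composing with the
    projection of BA onto sA. *)
Lemma amu_bar_pull s : bar_pull mu mu s = 0.
Proof.
pose pr (t : seq sA) : sA := if t is [:: x] then x else 0.
have prL : multilin pr.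
  move=> [|y [|z l]] [|x r] a u v //=; by rewrite ?scaler0 ?addr0.
rewrite -[RHS](amu_sq prL s); congr (bar_pull _ _ _); apply/funext => t.
rewrite bar_pullE; case: t => [|x t].
  by rewrite !cut_nil.
rewrite cut_cons [X in _ + X]cut0 ?addr0 => [|l r _]; last first.
  by rewrite cut0 // => u v _; rewrite /= ; case: (kmap 1 l).
by rewrite cut_last // => u [].
Qed.

End ModPull.

(** * The dg category of modules *)

Section Homs.
Variables (K : fieldType) (A : ainfAlg K).
Notation sA := (gshift A).
Notation mu := (@amu K A).
Implicit Types (L M N : ainfMod A) (d e : int) (r : nat).

Lemma is_hom_comp L M N d e (psi : cochain M N) (phi : cochain L M) :
  is_hom e psi -> is_hom d phi -> is_hom (e + d) (hom_comp d psi phi).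
Proof.
move=> [psiL psiH psiU] [phiL phiH phiU]; split=> [||l t m].
- exact: multilin_conv.
- by rewrite addrC; apply: homog_conv.
rewrite /hom_comp convE cut_cat !cut0 ?addr0 // => p q _.
  rewrite kmap_cat /= (koszul_gdeg _ (aunit_deg A)).
  by rewrite (linZ (psiL.2 _ _ _)) psiU scaler0.
by rewrite phiU (lin0 (psiL.1 _)).
Qed.

Lemma is_hom_lin M N d a (phi psi : cochain M N) :
  is_hom d phi -> is_hom d psi -> is_hom d (fun s m => a *: phi s m + psi s m).
Proof.
move=> [phiL phiH phiU] [psiL psiH psiU]; split=> [|ds s i m dss im|l t m].
- split=> [s c x y | m l t c x y].
    by rewrite phiL.1 psiL.1 !scalerDr !scalerA mulrC addrACA.
  by rewrite phiL.2 psiL.2 !scalerDr !scalerA mulrC addrACA.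
- rewrite /gdeg gprD gprZ (eqP (phiH _ _ _ _ dss im)).
  by rewrite (eqP (psiH _ _ _ _ dss im)).
by rewrite phiU psiU scaler0 addr0.
Qed.

Lemma is_hom0 M N d : @is_hom K A M N d (fun _ _ => 0).
Proof.
split=> // [|ds s i m _ _]; last by rewrite /gdeg gpr0.
by split=> [s a x y | m l t a x y]; rewrite scaler0 addr0.
Qed.

Lemma lin_sub (W : lmodType K) (a c : K) (p p' x x' : W) :
  a *: p + p' - c *: (a *: x + x') = a *: (p - c *: x) + (p' - c *: x').
Proof. by rewrite scalerBr scalerDr opprD addrACA !scalerA [a * c]mulrC. Qed.

Lemma hom_diff_lin M N d a (phi psi : cochain M N) s m :
  hom_diff d (fun s m => a *: phi s m + psi s m) s m =
    a *: hom_diff d phi s m + hom_diff d psi s m.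
Proof.
rewrite /hom_diff mod_pullD mod_pullZ convDr ?convZr; try exact: (mmu_lin N).1.
exact: lin_sub.
Qed.

(** The Leibniz rule; the sign is on the other side from the usual one because
    the differential acts by precomposition. *)
Lemma hom_diff_comp L M N d e (psi : cochain M N) (phi : cochain L M) s m :
  multilin_mod psi ->
  hom_diff (e + d) (hom_comp d psi phi) s m =
    hom_comp (d + 1) psi (hom_diff d phi) s m
    + ((-1 : K) ^ d) *: hom_comp d (hom_diff e psi) phi s m.
Proof.
move=> psiL; have [psi1 _] := psiL; have muN := (mmu_lin N).1.
rewrite /hom_comp /hom_diff mod_pull_conv // conv_assoc //.
have -> : conv (d + 1) psi (fun t n => mod_pull mu (@mmu K A L) phi t n
      - ((-1 : K) ^ d) *: conv d (@mmu K A M) phi t n) s m =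
    conv (d + 1) psi (mod_pull mu (@mmu K A L) phi) s m
    - ((-1 : K) ^ d) *: conv d (conv 1 psi (@mmu K A M)) phi s m.
  rewrite -(conv_assoc d 1) // [1 + d]addrC -scaleNr -convZr // -convDr //.
  by apply: eq_conv => // t n; rewrite scaleNr.
have -> : conv d (fun t n => mod_pull mu (@mmu K A M) psi t n
      - ((-1 : K) ^ e) *: conv e (@mmu K A N) psi t n) phi s m =
    conv d (conv 1 psi (@mmu K A M)) phi s m
    + conv d (fun t n => bar_pull mu (psi^~ n) t) phi s m
    - ((-1 : K) ^ e) *: conv d (conv e (@mmu K A N) psi) phi s m.
  by rewrite convDl convNl convZl convDl.
rewrite sign_add [_ * (-1) ^ d]mulrC -scalerA.
move: (conv _ _ _ _ _) (conv _ _ _ _ _) (conv _ _ _ _ _) (conv _ _ _ _ _) => x y z t.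
by rewrite scalerBr scalerDr -!addrA addKr.
Qed.

Lemma hom_diff_sq M N d (phi : cochain M N) s m : multilin_mod phi ->
  hom_diff (d + 1) (hom_diff d phi) s m = 0.
Proof.
move=> phiL; have [muNL muN2] := mmu_lin N.
pose P := mod_pull mu (@mmu K A M) phi.
pose C := conv d (@mmu K A N) phi.
have DE : hom_diff d phi = fun s m => (- (-1 : K) ^ d) *: C s m + P s m.
  by apply/funext => t; apply/funext => n; rewrite /hom_diff scaleNr addrC.
have PP t n : mod_pull mu (@mmu K A M) P t n = 0.
  rewrite mod_pull_sq //.
  rewrite convE cut0 // => l r _; rewrite mmu_mod_pull.
  exact: (lin0 (phiL.1 _)).
have MC t n : conv (d + 1) (@mmu K A N) C t n =
    - conv d (fun t n => bar_pull mu ((@mmu K A N)^~ n) t) phi t n.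
  rewrite [d + 1]addrC conv_assoc //; apply/eqP.
  rewrite -addr_eq0 -convDl; apply/eqP; rewrite convE cut0 // => l r _.
  exact: (mmu_mod_pull (M := N)).
rewrite DE hom_diff_lin {2}/hom_diff PP sub0r /hom_diff /=.
rewrite {1}/C mod_pull_conv; last exact: mmu_lin.
rewrite -/P MC sign_add expr1z mulrN1 !scaleNr !opprK.
move: (conv _ _ _ _ _) (conv _ _ _ _ _) => x y.
by rewrite scalerN addrK addNr.
Qed.

End Homs.

(** * Cohomology classes and multiplicativity of the length filtration *)

Section Classes.
Variables (K : fieldType) (A : ainfAlg K).
Implicit Types (L M N : ainfMod A) (d e : int) (r : nat).

Lemma cochain_ext M N (phi psi : cochain M N) :
  (forall s m, phi s m = psi s m) -> phi = psi.
Proof. by move=> e; apply/funext => s; apply/funext => m. Qed.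

Lemma cocycle_lin M N d a (phi psi : cochain M N) :
  cocycle d phi -> cocycle d psi -> cocycle d (fun s m => a *: phi s m + psi s m).
Proof.
move=> [phiH phi0] [psiH psi0]; split=> [|s m]; first exact: is_hom_lin.
by rewrite hom_diff_lin phi0 psi0 scaler0 addr0.
Qed.

Lemma coboundary_lin M N d a (phi psi : cochain M N) :
  coboundary d phi -> coboundary d psi ->
  coboundary d (fun s m => a *: phi s m + psi s m).
Proof.
move=> [h hH phiE] [k kH psiE]; exists (fun s m => a *: h s m + k s m).
  exact: is_hom_lin.
by move=> s m; rewrite hom_diff_lin phiE psiE.
Qed.

Lemma hom_diff0 M N d s m : @hom_diff K A M N d (fun _ _ => 0) s m = 0.
Proof.
rewrite (_ : (fun _ _ => 0) = fun s m => (-1) *: (0 : N) + 0); last first.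
  by apply: cochain_ext => t n; rewrite scaler0 addr0.
by rewrite hom_diff_lin scaleN1r addNr.
Qed.

Lemma cocycle0 M N d : @cocycle K A M N d (fun _ _ => 0).
Proof. by split=> [|s m]; [apply: is_hom0 | apply: hom_diff0]. Qed.

Lemma coboundary0 M N d : @coboundary K A M N d (fun _ _ => 0).
Proof.
exists (fun _ _ => 0); first exact: is_hom0.
by move=> s m; rewrite hom_diff0.
Qed.

Lemma cocycle_comp L M N d e (f : cochain M N) (g : cochain L M) :
  cocycle e f -> cocycle d g -> cocycle (e + d) (hom_comp d f g).
Proof.
move=> [fH f0] [gH g0]; split=> [|s m]; first exact: is_hom_comp.
have [fL _ _] := fH; rewrite hom_diff_comp // /hom_comp !convE !cut0 => [|l r _|l r _].
- by rewrite scaler0 addr0.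
- exact: f0.
- by rewrite g0 (lin0 (fL.1 _)).
Qed.

Lemma coboundary_compl L M N d e (f : cochain M N) (g : cochain L M) :
  cocycle e f -> coboundary d g -> coboundary (e + d) (hom_comp d f g).
Proof.
move=> [fH f0] [k kH gE]; exists (hom_comp (d - 1) f k).
  by rewrite -addrA; apply: is_hom_comp.
have [fL _ _] := fH.
move=> s m; rewrite -addrA hom_diff_comp // subrK.
rewrite [X in _ *: X](_ : _ = 0); last first.
  by rewrite /hom_comp convE cut0 // => l r _; apply: f0.
by rewrite scaler0 addr0; apply: eq_conv.
Qed.

Lemma coboundary_compr L M N d e (f : cochain M N) (g : cochain L M) :
  coboundary e f -> cocycle d g -> coboundary (e + d) (hom_comp d f g).
Proof.
move=> [h hH fE] [gH g0].
exists (fun s m => ((-1 : K) ^ d) *: hom_comp d h g s m + 0).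
  apply: is_hom_lin; last exact: is_hom0.
  by rewrite addrAC; apply: is_hom_comp.
have [hL _ _] := hH.
move=> s m; rewrite hom_diff_lin hom_diff0 addr0 addrAC hom_diff_comp //.
rewrite [X in X + _](_ : _ = 0); last first.
  by rewrite /hom_comp convE cut0 // => l r _; rewrite g0 (lin0 (hL.1 _)).
by rewrite add0r scalerA sqr_sign scale1r; apply: eq_conv.
Qed.

(** If s = l r is shorter than p + q, then l is shorter than p or r is shorter
    than q. *)
Lemma comp_filtration L M N d p q (f : cochain M N) (g : cochain L M) :
  (forall t, linear (f t)) ->
  (forall s m, (size s < p)%N -> f s m = 0) ->
  (forall s m, (size s < q)%N -> g s m = 0) ->
  forall s m, (size s < p + q)%N -> hom_comp d f g s m = 0.
Proof.
move=> fL f0 g0 s m sz; rewrite /hom_comp convE cut0 // => l t lt.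
move: sz; rewrite -lt size_cat => sz.
have [lp|pl] := ltnP (size l) p; first by rewrite f0 // size_map.
rewrite g0 ?(lin0 (fL _)) //; rewrite -(ltn_add2l (size l)).
by apply: leq_trans sz _; rewrite leq_add2r.
Qed.

Lemma in_filtration_comp L M N d e p q (f : cochain M N) (g : cochain L M) :
  in_filtration p d f -> in_filtration q e g ->
  in_filtration (p + q) (d + e) (hom_comp e f g).
Proof.
move=> [cf [f' [cf' f'0 ff']]] [cg [g' [cg' g'0 gg']]].
have [[f'L _ _] _] := cf'.
split; first exact: cocycle_comp.
exists (hom_comp e f' g'); split; first exact: cocycle_comp.
  by apply: comp_filtration => //; case: f'L.
have := coboundary_lin 1 (coboundary_compr ff' cg) (coboundary_compl cf' gg').
rewrite /cohomologous; congr coboundary; apply: cochain_ext => s m.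
rewrite scale1r /hom_comp.
rewrite (convDl e f (fun s m => - f' s m) g) convNl.
have -> : conv e f' (fun s m => g s m - g' s m) s m =
    conv e f' g s m - conv e f' g' s m.
  rewrite -[in RHS]scaleN1r -convZr; try by case: f'L.
  rewrite -convDr; try by case: f'L.
  by apply: eq_conv => // t n; rewrite scaleN1r.
by rewrite addrA subrK.
Qed.

Lemma in_filtration_lin M N d r a (f g : cochain M N) :
  in_filtration r d f -> in_filtration r d g ->
  in_filtration r d (fun s m => a *: f s m + g s m).
Proof.
move=> [cf [f' [cf' f'0 ff']]] [cg [g' [cg' g'0 gg']]].
split; first exact: cocycle_lin.
exists (fun s m => a *: f' s m + g' s m); split.
- exact: cocycle_lin.
- by move=> s m sr; rewrite f'0 // g'0 // scaler0 addr0.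
have := coboundary_lin a ff' gg'; congr coboundary; apply: cochain_ext => s m.
by rewrite scalerBr opprD addrACA.
Qed.

Lemma in_filtration0 M N d r : @in_filtration K A r M N d (fun _ _ => 0).
Proof.
split; first exact: cocycle0.
exists (fun _ _ => 0); split=> //; first exact: cocycle0.
have := coboundary0 M N d; congr coboundary; apply: cochain_ext => s m.
by rewrite subr0.
Qed.

Lemma in_filtration_sum M N d r k (g : 'I_k -> cochain M N) :
  (forall i, in_filtration r d (g i)) ->
  in_filtration r d (fun s m => \sum_(i < k) g i s m).
Proof.
elim: k g => [|k IHk] g gF.
  rewrite (_ : (fun s m => _) = fun _ _ => 0); first exact: in_filtration0.
  by apply: cochain_ext => s m; rewrite big_ord0.
have := in_filtration_lin 1 (gF ord0) (IHk _ (fun i => gF (lift ord0 i))).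
congr in_filtration; apply: cochain_ext => s m.
by rewrite scale1r big_ord_recl.
Qed.

Lemma in_filtration_cohom M N d r (f g : cochain M N) :
  cocycle d f -> cohomologous d f g -> in_filtration r d g -> in_filtration r d f.
Proof.
move=> cf fg [cg [g' [cg' g'0 gg']]]; split=> //; exists g'; split=> //.
have := coboundary_lin 1 fg gg'; congr coboundary; apply: cochain_ext => s m.
by rewrite scale1r addrA subrK.
Qed.

End Classes.

(** * Morphisms out of the free module *)

Section Free.
Variables (K : fieldType) (A : ainfAlg K).
Notation sA := (gshift A).
Notation mu := (@amu K A).
Implicit Types (L M N : ainfMod A) (d e : int) (r : nat).

(** Freezing the last argument at m turns phi : BA (x) M -> W into a map
    BA (x) A -> W, the module A being read as one more letter.  The integer i
    is the degree of m, past which the letters move; the further 1 in the sign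
    accounts for the shift of the last letter. *)
Definition at_point (M : gvect K) (W : lmodType K) (i : int) (m : M)
    (phi : seq sA -> M -> W) : seq sA -> A -> W :=
  fun s a => phi (rcons (kmap (i + 1) s) (koszul i (a : sA))) m.

(** At a word ending in the letter a, each term of phi b_M treats a in one of
    three ways: it is left alone or fed to the product of A (these terms
    assemble into the differential of A as a module), it is fed to the action
    on m, or only m is acted upon. *)
Lemma mod_pull_at_point (M : gvect K) (W : lmodType K) (nu : seq sA -> M -> M)
    i (m : M) (phi : seq sA -> M -> W) s a :
  multilin_mod phi ->
  mod_pull mu nu phi (rcons (kmap (i + 1) s) (koszul i (a : sA))) m =
    - ((-1 : K) ^ i) *: mod_pull mu (@reg_mu K A) (M := A) (at_point i m phi) s a
    + conv i phi (M := A) (at_point i m nu) s a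
    + phi (kmap 1 (rcons (kmap (i + 1) s) (koszul i (a : sA)))) (nu [::] m).
Proof.
move=> [phi1 phi2]; set b := koszul i _.
have kE l : kmap 1 (kmap (i + 1) l) = kmap i l :> seq sA.
  by rewrite kmapD addrCA kmap_parity.
have kE' l : kmap (i + 1) (kmap 1 l) = kmap i l :> seq sA.
  by rewrite kmapD -addrA kmap_parity.
have sE : (-1 : K) ^ (i + 1) = - (-1) ^ i by rewrite sign_add expr1z mulrN1.
rewrite {1}/mod_pull convE cut_rcons addrAC; congr (_ + _).
rewrite [LHS]addrC; congr (_ + _); last first.
  rewrite convE /kmap cut_map -!/(kmap _ _); apply: eq_cut => l r _.
  by rewrite -!/(kmap _ _) kE.
rewrite bar_pullE cut_rcons cut_nil amu_nil (lin0 (phi2 _ _ _)) addr0.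
rewrite /mod_pull bar_pullE convE -cutD cut_scale /kmap cut_map -!/(kmap _ _).
apply: eq_cut => l r _; rewrite -!/(kmap _ _) cut_rcons addrC kE scalerDr.
congr (_ + _).
  rewrite /at_point kE' /reg_mu (linN (koszul_linear (V := sA) i)).
  rewrite (koszul_homog i _ (@amu_lin K A) (@amu_deg K A)) mulr1 -scaleNr.
  rewrite -!cats1 (linZ (phi2 _ _ _)) scalerA mulrNN sqr_sign scale1r.
  by rewrite /kmap map_cat -!/(kmap _ _) kmapD.
rewrite cut_map cut_scale; apply: eq_cut => u v _; rewrite -!/(kmap _ _).
rewrite /at_point kmap_cat kE' rcons_cat /=.
rewrite (koszul_homog _ _ (@amu_lin K A) (@amu_deg K A)) mulr1 sE.
by rewrite (linZ (phi2 _ _ _)) scalerA mulrNN sqr_sign scale1r.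
Qed.

Lemma multilin_at_point (M : gvect K) (W : lmodType K) i (m : M)
    (phi : seq sA -> M -> W) :
  multilin_mod phi -> @multilin_mod K sA A W (at_point i m phi).
Proof.
move=> [phi1 phi2]; split=> [s a x y | x l t a y z]; rewrite /at_point.
  rewrite -!cats1 (_ : koszul i _ = a *: koszul i (x : sA) + koszul i (y : sA)).
    by rewrite phi2.
  exact: (koszul_linear (V := sA)).
by rewrite !kmap_cat /= !rcons_cat /= koszul_linear phi2.
Qed.

Lemma homog_at_point (M N : gvect K) i j d (m : M) (phi : seq sA -> M -> N) :
  homog_mod d phi -> gdeg j m -> @homog_mod K sA A N (j + d - 1) (at_point i m phi).
Proof.
move=> phiH jm ds s k a dss ka.
have ka' : gdeg (k - 1) (koszul i (a : sA)).
  have ka1 : @gdeg K sA (k - 1) a by rewrite /gdeg /= subrK.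
  by rewrite (koszul_gdeg _ ka1) gdegZ.
have dsa : all2 (@gdeg K sA) (rcons ds (k - 1))
    (rcons (kmap (i + 1) s) (koszul i (a : sA))).
  move: (kmap_gdeg (i + 1) dss); move: (kmap (i + 1) s) => {dss}s.
  elim: ds s => [|l ds IHds] [|y s] //=; first by rewrite ka'.
  by case/andP=> -> /IHds.
have := phiH _ _ _ _ dsa jm; rewrite -cats1 big_cat big_seq1 /=.
by congr gdeg; ring.
Qed.

Lemma at_point_unit (M : gvect K) (W : lmodType K) i (m : M)
    (phi : seq sA -> M -> W) : multilin_mod phi ->
  (forall l t x, phi (l ++ aunit A :: rcons t x) m = 0) ->
  forall l t a, at_point i m phi (l ++ aunit A :: t) a = 0.
Proof.
move=> [_ phi2] phi0 l t a; rewrite /at_point kmap_cat rcons_cat /=.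
rewrite (koszul_gdeg _ (aunit_deg A)) (linZ (phi2 _ _ _)).
by rewrite phi0 scaler0.
Qed.

(** Right multiplication by a cycle m, a |-> am; it is closed by the A-infinity
    relations of M. *)
Lemma point_cocycle M i (m : M) : gdeg i m -> mmu [::] m = 0 ->
  cocycle i (at_point i m (@mmu K A M) : cochain (regular A) M).
Proof.
move=> im m0; have mL := mmu_lin M; split.
  split.
  - exact: multilin_at_point.
  - by have := homog_at_point i (@mmu_deg K A M) im; rewrite addrK.
  apply: at_point_unit => // l t x; apply: mmu_unit.
  by rewrite size_cat size_rcons addnS.
move=> s a; rewrite /hom_diff.
have := mod_pull_at_point (@mmu K A M) i m s a mL.
rewrite mmu_mod_pull m0 (lin0 (mL.1 _)) addr0 => /eqP.
rewrite scaleNr eq_sym addrC subr_eq0 => /eqP ->.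
by rewrite scalerA sqr_sign scale1r subrr.
Qed.

Lemma reg_mu_at_unit s (a : A) :
  at_point 0 (aunit A : A) (@reg_mu K A) s a = if s is [::] then a else 0.
Proof.
rewrite /at_point /reg_mu koszul_id add0r /kmap map_rcons -!/(kmap _ _) kmapD.
case: s => [|x s] /=; first by rewrite amu_unitr opprK koszulK.
by rewrite -rcons_cons -cats1 amu_unit ?oppr0 // cats0 /= size_rcons.
Qed.

(** The homotopy sends (s, a) to w(s a, 1): freezing the last argument of
    D w = 0 at the unit gives D y = w, the strict unit axioms leaving only the
    term w(s, a 1) and the hypothesis removing the action on w(1). *)
Lemma regular_nullhomotopy N d (w : cochain (regular A) N) :
  cocycle d w -> w [::] (aunit A : A) = 0 -> coboundary d w.
Proof.
move=> [[wL wH wU] w0] w1.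
pose y : cochain (regular A) N := at_point 0 (aunit A : A) w.
exists y.
  split; first exact: multilin_at_point.
  - have := homog_at_point (j := 0) 0 wH (m := (aunit A : A)); rewrite add0r; apply.
    by have := aunit_deg A; rewrite /gdeg /= addNr.
  by apply: at_point_unit => // l t x; apply: wU.
move=> s a; have := w0 (rcons (kmap 1 s) (koszul 0 (a : sA))) (aunit A : A).
rewrite /hom_diff -[in kmap 1 s](add0r 1).
have -> := mod_pull_at_point (@reg_mu K A) 0 (aunit A : A) s a wL.
have -> : @reg_mu K A [::] (aunit A : A) = 0.
  by rewrite /reg_mu /= (amu_unit (l := [::]) (r := [::])) ?oppr0.
have -> : conv 0 w (at_point 0 (aunit A : A) (@reg_mu K A)) s a = w s a.
  rewrite convE cut_last => [|l [|x r] _] //; rewrite reg_mu_at_unit ?kmap_id //.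
  exact: (lin0 (wL.1 _)).
have -> : conv d (@mmu K A N) w (rcons (kmap (0 + 1) s) (koszul 0 (a : sA)))
    (aunit A : A) = conv (d - 1) (@mmu K A N) y s a.
  rewrite !convE cut_rcons w1 (lin0 ((mmu_lin N).1 _)) addr0 /kmap cut_map.
  apply: eq_cut => l r _; rewrite -!/(kmap _ _) kmapD add0r.
  by rewrite -(kmap_parity (d - 1) 1) addrA subrK.
rewrite (lin0 (wL.1 _)) addr0 expr0z scaleN1r sign_add exprN1 invrN1 mulrN1.
move: (mod_pull _ _ _ _ _) (conv _ _ _ _ _) (w s a) => p c x e.
apply/eqP; rewrite -subr_eq0; apply/eqP; rewrite -e scaleNr opprK opprD addrA.
by rewrite [x - p]addrC.
Qed.

(** If f vanishes on the empty word, then the linear part of f x vanishes for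
    every x, in particular at the unit. *)
Lemma filtration1_ghost M N d (f : cochain M N) : in_filtration 1 d f -> ghost d f.
Proof.
move=> [cf [f' [cf' f'0 ff']]]; split=> // e x cx.
have f'x : coboundary (d + e) (hom_comp e f' x).
  apply: regular_nullhomotopy; first exact: cocycle_comp.
  by rewrite /hom_comp convE cut_nil f'0.
have := coboundary_lin 1 (coboundary_compr ff' cx) f'x; congr coboundary.
apply: cochain_ext => s m; rewrite scale1r /hom_comp -convDl.
by apply: eq_conv => // t n; rewrite subrK.
Qed.

End Free.

(** * Null-homotopic chain maps over a field *)

Section LinearSelection.
Variables (K : fieldType) (U W : lmodType K).

(** Every linear relation contains the graph of a linear map on its domain.
    Apply Zorn's lemma to partial linear maps, given by their graphs T, which
    select in R wherever R is defined. *)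
Lemma linear_selection (R : U -> W -> Prop) :
  (forall a u w u' w', R u w -> R u' w' -> R (a *: u + u') (a *: w + w')) ->
  exists2 h : U -> W, linear h & forall u w, R u w -> R u (h u).
Proof.
move=> RL.
pose P (T : set (U * W)) :=
  [/\ forall a u w u' w', T (u, w) -> T (u', w') -> T (a *: u + u', a *: w + w'),
      forall w, T (0, w) -> w = 0
    & forall u w w', T (u, w) -> R u w' -> R u w].
have [F FP Ftot|T [[TL T0 TR] Tmax]] := @Zorn_bigcup (U * W)%type P.
  split=> [a u w u' w' [X FX Xu] [Y FY Yu] | w [X FX Xu] | u w w' [X FX Xu]].
  - have [XY|YX] := Ftot _ _ FX FY.
      by exists Y => //; have [YL _ _] := FP _ FY; apply: YL => //; apply: XY.
    by exists X => //; have [XL _ _] := FP _ FX; apply: XL => //; apply: YX.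
  - by have [_ X0 _] := FP _ FX; apply: X0.
  - by have [_ _ XR] := FP _ FX; apply: XR.
have R0 w : R 0 w -> R 0 0.
  by move=> Rw; have := RL (-1) _ _ _ _ Rw Rw; rewrite scaler0 addr0 scaleN1r addNr.
have T00 : T (0, 0).
  apply: contrapT => nT.
  have Te u w : ~ T (u, w).
    by move=> Tu; apply: nT; have := TL (-1) _ _ _ _ Tu Tu; rewrite !scaleN1r !addNr.
  apply: (Tmax [set x | x = (0, 0)]%classic).
    by split=> [[u w] /Te //|sub]; apply: nT; apply: sub.
  split=> [a u w u' w' [-> ->] [-> ->] | w [->] | u w w' [-> ->] /R0] //=.
  by rewrite !scaler0 !addr0.
have Tz a u w : T (u, w) -> T (a *: u, a *: w).
  by move=> Tu; have := TL a _ _ _ _ Tu T00; rewrite !addr0.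
have Ttot u0 : exists w0, T (u0, w0).
  apply: contrapT => nT.
  (* the value w0 given to u0 is read off R as soon as R is defined on some
     translate of u0 by the domain of T, and is arbitrary otherwise *)
  have [w0 w0P] : exists w0, forall t s w, T (t, s) -> R (u0 + t) w ->
      exists t s, T (t, s) /\ R (u0 + t) (w0 + s).
    have [[t [s [w [Tt Rt]]]]|no] :=
        pselect (exists t s w, T (t, s) /\ R (u0 + t) w).
      by exists (w - s) => _ _ _ _ _; exists t, s; rewrite subrK.
    by exists 0 => t s w Tt Rt; case: no; exists t, s, w.
  pose T' : set (U * W) :=
    [set x | exists a u w, T (u, w) /\ x = (a *: u0 + u, a *: w0 + w)]%classic.
  have nT' a u w : T (u, w) -> a *: u0 + u = 0 -> a = 0.
    move=> Tu e; have [//|a0] := eqVneq a 0; case: nT.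
    exists (- a^-1 *: w); have := Tz (- a^-1) _ _ Tu.
    rewrite (_ : - a^-1 *: u = u0) //.
    have -> : u = - (a *: u0) by apply/eqP; rewrite -addr_eq0 addrC e.
    by rewrite scaleNr scalerN opprK scalerA mulVf // scale1r.
  apply: (Tmax T').
    split=> [[u w] Tu|sub].
      by exists 0, u, w; rewrite !scale0r !add0r.
    case: nT; exists w0; apply: sub; exists 1, 0, 0.
    by rewrite !scale1r !addr0.
  split=> [a _ _ _ _ [b [u [w [Tu [-> ->]]]]] [c [u' [w' [Tu' [-> ->]]]]]
          | w [a [u [s [Tu [/esym e ->]]]]] | _ _ w' [a [u [w [Tu [-> ->]]]]] Rw'].
  - exists (a * b + c), (a *: u + u'), (a *: w + w'); split; first exact: TL.
    by rewrite !scalerDr !scalerDl !scalerA; congr (_, _); rewrite addrACA.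
  - have a0 := nT' _ _ _ Tu e; move: e Tu; rewrite a0 !scale0r !add0r => ->.
    exact: T0.
  have [a0|a0] := eqVneq a 0.
    by move: Rw'; rewrite a0 !scale0r !add0r; apply: TR.
  have Rz b x y : R x y -> R (b *: x) (b *: y).
    by move=> Rx; have := RL (b - 1) _ _ _ _ Rx Rx; rewrite !scalerBl !scale1r !subrK.
  have [|t [s [Tt Rt]]] := w0P (a^-1 *: u) (a^-1 *: w) (a^-1 *: w') (Tz _ _ _ Tu).
    have := Rz a^-1 _ _ Rw'.
    by rewrite scalerDr scalerA mulVf // scale1r.
  have Rd : R (u - a *: t) (w - a *: s).
    have Td : T (u - a *: t, w - a *: s).
      by have := TL (- a) _ _ _ _ Tt Tu; rewrite !scaleNr addrC [_ + w]addrC.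
    apply: (TR _ _ (w' - a *: (w0 + s)) Td).
    have := RL (- a) _ _ _ _ Rt Rw'.
    by rewrite !scaleNr scalerDr opprD addrACA addNr add0r ![- _ + _]addrC.
  have := RL a _ _ _ _ Rt Rd.
  by rewrite !scalerDr -!addrA ![a *: _ + (_ - a *: _)]addrC !subrK.
have [h hP] := choice Ttot; exists h; last by move=> u w; apply: TR.
move=> a u v; apply/eqP; rewrite -subr_eq0; apply/eqP; apply: T0.
have := TL (-1) _ _ _ _ (TL a _ _ _ _ (hP u) (hP v)) (hP (a *: u + v)).
by rewrite !scaleN1r addNr [- _ + _]addrC.
Qed.

End LinearSelection.

(** Split the complex U: the section s of dU on its image gives a projection
    p = 1 - s dU onto the cycles, and then dU s projects the cycles onto the
    boundaries.  The homotopy is f s on the boundaries, where it is forced, a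
    lift k of f along dW on a complement among the cycles, and 0 on im (s dU). *)
Lemma chain_homotopy (K : fieldType) (U W : lmodType K)
    (dU : U -> U) (dW : W -> W) (f : U -> W) (c : K) :
  linear dU -> linear dW -> linear f -> c * c = 1 ->
  (forall u, dU (dU u) = 0) -> (forall u, f (dU u) = c *: dW (f u)) ->
  (forall u, dU u = 0 -> exists w, dW w = f u) ->
  exists2 h : U -> W, linear h & forall u, f u = h (dU u) + c *: dW (h u).
Proof.
move=> dUL dWL fL cc dd fd fex.
have [|s sL sP] := @linear_selection K U U (fun b u => dU u = b).
  by move=> a u w u' w' <- <-; rewrite dUL.
have [|k kL kP] := @linear_selection K U W (fun z w => dU z = 0 /\ c *: dW w = f z).
  move=> a u w u' w' [u0 e] [u0' e']; rewrite dUL u0 u0' scaler0 addr0; split=> //.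
  by rewrite fL -e -e' dWL scalerDr !scalerA mulrC.
have dsd u : dU (s (dU u)) = dU u by apply: sP erefl.
have kZ z : dU z = 0 -> c *: dW (k z) = f z.
  move=> z0; have [w wE] := fex _ z0.
  suff [] : dU z = 0 /\ c *: dW (k z) = f z by [].
  apply: (kP z (c *: w)); split=> //.
  by rewrite (linZ dWL) scalerA cc scale1r.
pose p u := u - s (dU u).
have pL : linear p.
  by move=> a u v; rewrite /p dUL sL scalerBr opprD addrACA.
have dp u : dU (p u) = 0 by rewrite /p (linD dUL) (linN dUL) dsd subrr.
pose g u := f (s (dU (s u))) + k (u - dU (s u)).
have gL : linear g.
  move=> a u v; rewrite /g !(sL, dUL, fL) opprD addrACA -scalerBr kL.
  by rewrite scalerDr addrACA.
exists (g \o p) => [a u v|u] /=; first by rewrite pL gL.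
have -> : p (dU u) = dU u by rewrite /p dd (lin0 sL) subr0.
rewrite {1}/g !dsd subrr (lin0 kL) addr0 /g.
rewrite (linD dWL) scalerDr -fd kZ; last by rewrite (linD dUL) (linN dUL) dd dp subrr.
rewrite dsd -(linD fL) [_ + (p u - _)]addrC subrK -(linD fL).
by rewrite /p addrC subrK.
Qed.

(** * Homogeneous components of linear maps *)

Section GradedMaps.
Variables (K : fieldType).
Implicit Types (U V W : gvect K).

Lemma gprN V i (x : V) : gpr i (- x) = - gpr i x.
Proof. by rewrite -scaleN1r gprZ scaleN1r. Qed.

Lemma gpr_sumE V i I (s : seq I) (F : I -> V) :
  gpr i (\sum_(j <- s) F j) = \sum_(j <- s) gpr i (F j).
Proof. exact: (lin_sum (gpr_linear i)). Qed.

Lemma homog_ext U (W : lmodType K) (f g : U -> W) : linear f -> linear g ->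
  (forall i x, gdeg i x -> f x = g x) -> f =1 g.
Proof.
move=> fL gL e x; have [_ ->] := gsuppP x.
rewrite (lin_sum fL) (lin_sum gL); apply: eq_bigr => i _.
exact: (e i _ (gdeg_gpr i x)).
Qed.

Definition degree_map U W (d : int) (f : U -> W) : Prop :=
  forall i x, gdeg i x -> gdeg (i + d) (f x).

Lemma gpr_degree_map U W d (f : U -> W) : linear f -> degree_map d f ->
  forall k x, gpr k (f x) = f (gpr (k - d) x).
Proof.
move=> fL fd k; apply: homog_ext => [a x y|a x y|i x xi].
- by rewrite fL gprD gprZ.
- by rewrite gprD gprZ fL.
rewrite -(eqP (fd _ _ xi)) gpr_proj -(eqP xi) gpr_proj (eqP xi).
by rewrite (eqP (fd _ _ xi)) subr_eq; case: ifP => // _; rewrite (lin0 fL).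
Qed.

(** The degree d component of a linear map, which need not be a finite sum of
    homogeneous maps. *)
Definition gcomponent U W (d : int) (f : U -> W) (x : U) : W :=
  \sum_(j <- gsupp x) gpr (j + d) (f (gpr j x)).

Lemma gpr_gcomponent U W d (f : U -> W) : linear f ->
  forall k x, gpr k (gcomponent d f x) = gpr k (f (gpr (k - d) x)).
Proof.
move=> fL k x; have [us xE] := gsuppP x.
rewrite /gcomponent gpr_sumE; have [kx|kx] := boolP (k - d \in gsupp x).
  rewrite (bigD1_seq (k - d)) //= subrK gpr_proj eqxx big1 ?addr0 // => j jk.
  by rewrite gpr_proj -subr_eq eq_sym (negPf jk).
rewrite (gpr_notin kx) (lin0 fL) gpr0 big1_seq // => j /andP[_ jx].
rewrite gpr_proj -subr_eq; case: eqP => // e.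
by move: kx; rewrite e jx.
Qed.

Lemma gcomponent_linear U W d (f : U -> W) : linear f -> linear (gcomponent d f).
Proof.
move=> fL a x y; apply: gprP => k.
by rewrite gprD gprZ !gpr_gcomponent // gprD gprZ fL gprD gprZ.
Qed.

Lemma gcomponent_degree U W d (f : U -> W) : linear f ->
  degree_map d (gcomponent d f).
Proof.
move=> fL i x xi; apply/eqP/gprP => k; rewrite gpr_proj.
case: eqVneq => [->//|ki]; rewrite gpr_gcomponent // -(eqP xi) gpr_proj subr_eq.
by rewrite (negPf ki) (lin0 fL) gpr0.
Qed.

End GradedMaps.

(** * Ghosts vanish on cohomology *)

Section Strict.
Variables (K : fieldType) (A : ainfAlg K).
Notation sA := (gshift A).
Notation mu := (@amu K A).
Implicit Types (L M N : ainfMod A) (d e : int) (r : nat).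

(** The cochain with linear part h and no higher part. *)
Definition strict M N (h : M -> N) : cochain M N :=
  fun s m => if s is [::] then h m else 0.

Lemma mod_pull_strict M N (h : M -> N) s m :
  mod_pull mu (@mmu K A M) (strict h) s m = h (mmu s m).
Proof.
rewrite /mod_pull bar_pullE [X in _ + X]cut0 ?addr0 => [|[|x l] r _]; last first.
- by rewrite cut0.
- by rewrite cut0.
by rewrite convE cut_first.
Qed.

Lemma conv_strict L M N d (f : cochain M N) (h : L -> M) s m :
  (forall t, linear (f t)) -> hom_comp d f (strict h) s m = f (kmap d s) (h m).
Proof.
by move=> fL; rewrite /hom_comp convE cut_last // => l [|x r] // _; apply: lin0.
Qed.

Lemma strict_conv L M N d (h : M -> N) (f : cochain L M) s m :
  hom_comp d (strict h) f s m = h (f s m).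
Proof.
by rewrite /hom_comp convE cut_first.
Qed.

Lemma hom_diff_strict M N d (h : M -> N) s m :
  hom_diff d (strict h) s m = h (mmu s m) - ((-1 : K) ^ d) *: mmu (kmap d s) (h m).
Proof.
rewrite /hom_diff mod_pull_strict; congr (_ - _ *: _).
exact: (conv_strict _ _ _ _ (mmu_lin N).1).
Qed.

Lemma strict_is_hom M N d (h : M -> N) :
  linear h -> degree_map d h -> is_hom d (strict h).
Proof.
move=> hL hd; split=> [|[|e ds] [|x s] i m //= _ im|[|y l] t m] //.
- by split=> [[|x s] // a u v | m [|y l] t a u v] /=; rewrite ?scaler0 ?addr0.
- by rewrite big_nil add0r; apply: hd.
by rewrite /gdeg gpr0.
Qed.

(** Only the unit axioms need care: at a word containing the unit both terms of
    the differential vanish, except at the word 1, where they cancel. *)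
Lemma strict_boundary_cocycle M N d (h : M -> N) :
  linear h -> degree_map d h -> cocycle (d + 1) (hom_diff d (strict h)).
Proof.
move=> hL hd; have [sL sH sU] := strict_is_hom hL hd.
have NL := mmu_lin N.
split; last by move=> s m; apply: hom_diff_sq.
have DL : multilin_mod (hom_diff d (strict h)).
  have [C1 C2] := multilin_conv d NL sL.
  have [B1 B2] := multilin_conv 1 sL (mmu_lin M).
  have [E1 E2] := multilin_bar (@amu_lin K A) sL.
  rewrite (_ : hom_diff d _ = fun s m =>
      (conv 1 (strict h) (@mmu K A M) s m + bar_pull mu ((strict h)^~ m) s)
      - ((-1 : K) ^ d) *: conv d (@mmu K A N) (strict h) s m) //.
  split=> [s a x y|m l r a x y].
    rewrite B1 E1 C1 -lin_sub; congr (_ - _).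
    by rewrite scalerDr addrACA.
  rewrite B2 E2 C2 -lin_sub; congr (_ - _).
  by rewrite scalerDr addrACA.
split=> // [ds s i m dss im|l t m]; rewrite hom_diff_strict.
  have mH : gdeg (\sum_(j <- ds) j + i + (d + 1)) (h (mmu s m)).
    by have := hd _ _ (mmu_deg dss im); congr gdeg; ring.
  have nH : gdeg (\sum_(j <- ds) j + i + (d + 1)) (mmu (kmap d s) (h m)).
    by have := mmu_deg (kmap_gdeg d dss) (hd _ _ im); congr gdeg; ring.
  by rewrite /gdeg gprD gprN gprZ (eqP mH) (eqP nH).
have [|lt] := boolP (size (l ++ t) != 0%N).
  move=> lt; rewrite mmu_unit // (lin0 hL) sub0r kmap_cat /=.
  rewrite (koszul_gdeg _ (aunit_deg A)) (linZ (NL.2 _ _ _)).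
  by rewrite mmu_unit ?scaler0 ?oppr0 // size_cat !size_map -size_cat.
have [-> ->] : l = [::] /\ t = [::] by move: lt; case: l; case: t.
rewrite /= mmu_unitl (koszul_gdeg _ (aunit_deg A)).
have /= -> := linZ (NL.2 (h m) [::] [::]).
by rewrite mmu_unitl scalerA -sign_add mulrN1 subrr expr0z scale1r subrr.
Qed.

Lemma mmu_nil_deg M : degree_map 1 (@mmu K A M [::]).
Proof.
move=> i y yi; have := mmu_deg (ds := [::]) (s := [::]) isT yi.
by rewrite big_nil add0r.
Qed.

Lemma hom_diff_nil M N d (f : cochain M N) m : multilin_mod f ->
  hom_diff d f [::] m =
    f [::] (mmu [::] m) - ((-1 : K) ^ d) *: mmu [::] (f [::] m).
Proof. by move=> fL; rewrite /hom_diff mod_pull_nil // convE cut_nil. Qed.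

(** Composing f with the cocycles [point_cocycle] shows that the linear part of
    f maps cycles to boundaries.  A homotopy of the linear part, replaced by its
    component of degree d - 1, is extended by zero, and f minus its boundary
    vanishes on the empty word. *)
Lemma ghost_filtration1 M N d (f : cochain M N) : ghost d f -> in_filtration 1 d f.
Proof.
move=> [cf gf]; have [[fL fH fU] f0] := cf.
pose dM := @mmu K A M [::]; pose dN := @mmu K A N [::].
have dML : linear dM by apply: (mmu_lin M).1.
have dNL : linear dN by apply: (mmu_lin N).1.
have f0L : linear (f [::]) by apply: fL.1.
have fd u : f [::] (dM u) = ((-1 : K) ^ d) *: dN (f [::] u).
  have := f0 [::] u.
  by rewrite hom_diff_nil // => /eqP; rewrite subr_eq0 => /eqP.
have sq (P : ainfMod A) (u : P) : mmu [::] (mmu [::] u) = 0.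
  by have := mmu_mod_pull [::] u; rewrite mod_pull_nil //; apply: mmu_lin.
have dMd : degree_map 1 dM := @mmu_nil_deg M.
have dNd : degree_map 1 dN := @mmu_nil_deg N.
have fdeg : degree_map d (f [::]).
  by move=> i x xi; have := fH [::] [::] _ _ isT xi; rewrite big_nil add0r.
have exH i u : gdeg i u -> dM u = 0 -> exists w, dN w = f [::] u.
  move=> iu u0; have [y [yL _ _] yE] := gf _ _ (point_cocycle iu u0).
  have := yE [::] (aunit A : A).
  rewrite /hom_comp convE cut_nil /at_point /= (koszul_gdeg _ (aunit_deg A)).
  have /= -> := linZ ((mmu_lin M).2 u [::] [::]).
  rewrite mmu_unitl (linZ f0L) hom_diff_nil // /= /reg_mu /=.
  rewrite (amu_unit (l := [::]) (r := [::])) // oppr0 (lin0 (yL.1 _)) sub0r.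
  set c := _ ^ _; set c' := _ ^ _ => e.
  exists (- (c * c') *: y [::] (aunit A : A)).
  rewrite (linZ dNL) scaleNr -scalerA -scalerN -e scalerA.
  by rewrite sqr_sign scale1r.
have ex u : dM u = 0 -> exists w, dN w = f [::] u.
  move=> u0; have exi i : exists w, dN w = f [::] (gpr i u).
    apply: (exH i); first exact: gdeg_gpr.
    have := gpr_degree_map dML dMd (i + 1) u.
    by rewrite addrK u0 gpr0.
  have [w wE] := choice exi; have [_ uE] := gsuppP u.
  exists (\sum_(i <- gsupp u) w i); rewrite [in RHS]uE.
  by rewrite (lin_sum dNL) (lin_sum f0L); apply: eq_bigr.
have [h hL hE] := chain_homotopy dML dNL f0L (sqr_sign K d) (sq M) fd ex.
pose k := gcomponent (d - 1) h.
have kL : linear k by apply: gcomponent_linear.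
have kd : degree_map (d - 1) k by apply: gcomponent_degree.
have kE u : f [::] u = k (dM u) + ((-1 : K) ^ d) *: dN (k u).
  apply: gprP => j; rewrite gprD gprZ (gpr_degree_map f0L fdeg).
  rewrite (gpr_degree_map dNL dNd) !gpr_gcomponent //.
  rewrite (gpr_degree_map dML dMd).
  have -> : j - (d - 1) - 1 = j - d by ring.
  have -> : j - 1 - (d - 1) = j - d by ring.
  have uj : gdeg (j - d) (gpr (j - d) u) := gdeg_gpr _ _.
  move: (gpr (j - d) u) uj => v vj.
  have vE : gpr j (f [::] v) = f [::] v.
    by have := fdeg _ _ vj; rewrite subrK => /eqP.
  by rewrite -[LHS]vE hE gprD gprZ (gpr_degree_map dNL dNd).
split=> //; exists (fun s m => (-1) *: hom_diff (d - 1) (strict k) s m + f s m).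
have kc := strict_boundary_cocycle kL kd; rewrite subrK in kc.
split.
- exact: cocycle_lin.
- case=> // m _; rewrite hom_diff_strict scaleN1r kE /= sign_add exprN1 invrN1.
  by rewrite mulrN1 scaleNr opprK addNr.
exists (strict k); first exact: strict_is_hom.
by move=> s m; rewrite scaleN1r opprD opprK addrCA subrr addr0.
Qed.

Lemma ghost_comp_filtration r M N d (f : cochain M N) :
  ghost_comp r d f -> in_filtration r d f.
Proof.
elim=> [{}M {}N {}d {}f|{}r L {}M {}N {}d e {}f g _ IHf gg].
  exact: ghost_filtration1.
by rewrite -addn1; apply: in_filtration_comp => //; apply: ghost_filtration1.
Qed.

End Strict.

(** * The graded space of linear maps *)

Section GradedHom.
Variables (K : fieldType).
Implicit Types (U V W : gvect K).

(** The finite sums of homogeneous linear maps, characterised by the finite set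
    ds of degrees of their components; they form the graded Hom space, which is
    a direct sum and not a product. *)
Definition graded_map U W (f : U -> W) : Prop :=
  linear f /\ exists ds : seq int,
    forall j k x, k - j \notin ds -> gpr k (f (gpr j x)) = 0.

Lemma graded_map_lin U W a (f g : U -> W) :
  graded_map f -> graded_map g -> graded_map (fun x => a *: f x + g x).
Proof.
move=> [fL [ds fds]] [gL [es ges]]; split=> [b x y|].
  by rewrite fL gL !scalerDr !scalerA mulrC addrACA.
exists (ds ++ es) => j k x; rewrite mem_cat negb_or => /andP[kd ke].
by rewrite gprD gprZ fds // ges // scaler0 addr0.
Qed.

Lemma graded_map0 U W : graded_map (fun _ : U => 0 : W).
Proof.
split=> [b x y|]; first by rewrite scaler0 addr0.
by exists [::] => j k x _; rewrite gpr0.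
Qed.

Lemma graded_mapD U W (f g : U -> W) :
  graded_map f -> graded_map g -> graded_map (fun x => f x + g x).
Proof.
move=> fG gG; have := graded_map_lin 1 fG gG; congr graded_map.
by apply/funext => x; rewrite scale1r.
Qed.

Lemma graded_mapN U W (f : U -> W) : graded_map f -> graded_map (fun x => - f x).
Proof.
move=> fG; have := graded_map_lin (-1) fG (graded_map0 U W); congr graded_map.
by apply/funext => x; rewrite scaleN1r addr0.
Qed.

Lemma graded_map_sum U W I (r : seq I) (F : I -> U -> W) :
  (forall i, graded_map (F i)) -> graded_map (fun x => \sum_(i <- r) F i x).
Proof.
move=> FG; elim: r => [|i r IHr].
  rewrite (_ : (fun _ => _) = fun _ : U => 0 : W); first exact: graded_map0.
  by apply/funext => x; rewrite big_nil.
rewrite (_ : (fun _ => _) = fun x => F i x + \sum_(j <- r) F j x).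
  exact: graded_mapD.
by apply/funext => x; rewrite big_cons.
Qed.

Lemma degree_map_graded U W d (f : U -> W) :
  linear f -> degree_map d f -> graded_map f.
Proof.
move=> fL fd; split=> //; exists [:: d] => j k x; rewrite inE => kj.
rewrite (gpr_degree_map fL fd) gpr_proj; case: eqP => [e|_]; last exact: lin0.
by move: kj; rewrite -e opprB addrC subrK eqxx.
Qed.

Lemma koszul_graded U d : graded_map (koszul d : U -> U).
Proof.
apply: (@degree_map_graded U U 0); first exact: koszul_linear.
by move=> i x xi; rewrite addr0 (koszul_gdeg _ xi) gdegZ.
Qed.

Lemma graded_map_comp U V W (f : U -> V) (g : V -> W) :
  graded_map f -> graded_map g -> graded_map (fun x => g (f x)).
Proof.
move=> [fL [ds fds]] [gL [es ges]]; split=> [a x y|]; first by rewrite fL gL.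
exists [seq d + e | d <- ds, e <- es] => j k x kj.
have [us ->] := gsuppP (f (gpr j x)).
rewrite (lin_sum gL) gpr_sumE big1_seq // => i /andP[_ ix].
have [id|/fds-> //] := boolP (i - j \in ds); last by rewrite (lin0 gL) gpr0.
apply: ges; apply: contra kj => ki.
by apply/allpairsP; exists (i - j, k - i); split=> //=; ring.
Qed.

Definition graded_map_pred U W : {pred (U -> W)} := fun f => `[< graded_map f >].

Fact graded_map_submod U W : GRing.submod_closed (@graded_map_pred U W).
Proof.
split=> [|a f g /asboolP fG /asboolP gG]; apply/asboolP.
  exact: graded_map0.
exact: graded_map_lin.
Qed.

HB.instance Definition _ U W :=
  GRing.isSubmodClosed.Build K (U -> W) (@graded_map_pred U W)
    (@graded_map_submod U W).

Record ghom_type U W := GHom {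
  ghom_fun :> U -> W; ghom_graded : ghom_fun \in @graded_map_pred U W }.

HB.instance Definition _ U W := [isSub for @ghom_fun U W].
HB.instance Definition _ U W := [Choice of ghom_type U W by <:].
HB.instance Definition _ U W := [SubChoice_isSubLmodule of ghom_type U W by <:].

Definition ghom_of U W (f : U -> W) (fG : graded_map f) : ghom_type U W :=
  GHom (introT (asboolP _) fG).

Lemma ghomP U W (f : ghom_type U W) : graded_map f.
Proof. by apply/asboolP; case: f. Qed.

Lemma ghom_ext U W (f g : ghom_type U W) : f =1 g -> f = g.
Proof. by move=> e; apply: val_inj; apply/funext. Qed.

Lemma ghomD U W (f g : ghom_type U W) x : (f + g) x = f x + g x.
Proof. by []. Qed.

Lemma ghomZ U W a (f : ghom_type U W) x : (a *: f) x = a *: f x.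
Proof. by []. Qed.

Lemma ghom0 U W x : (0 : ghom_type U W) x = 0.
Proof. by []. Qed.

Lemma ghom_sum U W I (r : seq I) (F : I -> ghom_type U W) x :
  (\sum_(i <- r) F i) x = \sum_(i <- r) F i x.
Proof. by elim: r => [|i r IHr]; rewrite ?big_nil ?ghom0 // !big_cons ghomD IHr. Qed.

Fact gcomponent_graded U W d (f : ghom_type U W) : graded_map (gcomponent d f).
Proof.
have [fL _] := ghomP f; apply: (@degree_map_graded _ _ d).
  exact: gcomponent_linear.
exact: gcomponent_degree.
Qed.

Definition ghom_pr U W d (f : ghom_type U W) : ghom_type U W :=
  ghom_of (gcomponent_graded d f).

Lemma ghom_prE U W d (f : ghom_type U W) x : ghom_pr d f x = gcomponent d f x.
Proof. by []. Qed.

Fact ghom_pr_linear U W d : linear (@ghom_pr U W d).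
Proof.
move=> a f g; apply: ghom_ext => x; apply: gprP => k.
rewrite ghomD ghomZ gprD gprZ !ghom_prE !gpr_gcomponent; try exact: (ghomP _).1.
by rewrite ghomD ghomZ gprD gprZ.
Qed.

Fact ghom_pr_proj U W i j (f : ghom_type U W) :
  ghom_pr i (ghom_pr j f) = if i == j then ghom_pr j f else 0.
Proof.
have [fL _] := ghomP f.
apply: ghom_ext => x; apply: gprP => k.
rewrite ghom_prE gpr_gcomponent; last exact: gcomponent_linear.
rewrite ghom_prE gpr_gcomponent // gpr_proj (inj_eq (addrI k)) (inj_eq oppr_inj).
rewrite eq_sym; case: eqP => [->|_]; first by rewrite ghom_prE gpr_gcomponent.
by rewrite (lin0 fL) ghom0 !gpr0.
Qed.

Fact ghom_pr_sum U W (f : ghom_type U W) : exists s : seq int,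
  uniq s && (f == \sum_(i <- s) ghom_pr i f).
Proof.
have [fL [ds fds]] := ghomP f; exists (undup ds); rewrite undup_uniq /=.
apply/eqP/ghom_ext; apply: homog_ext => //.
  by have [] := ghomP (\sum_(i <- undup ds) ghom_pr i f).
move=> j x xj; apply: gprP => k; rewrite ghom_sum gpr_sumE.
have prE i : gpr k (ghom_pr i f x) = if i == k - j then gpr k (f x) else 0.
  rewrite ghom_prE gpr_gcomponent // -{1}(eqP xj) gpr_proj (eqP xj).
  rewrite subr_eq addrC -subr_eq eq_sym.
  by case: eqP => // _; rewrite (lin0 fL) gpr0.
under eq_bigr => i _ do rewrite prE.
rewrite -big_mkcond /=; have [kj|kj] := boolP (k - j \in undup ds).
  by rewrite -big_filter filter_pred1_uniq ?undup_uniq // big_seq1.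
rewrite -{1}(eqP xj) fds -1?mem_undup // big1_seq // => i /andP[/eqP-> ids].
by move: kj; rewrite ids.
Qed.

Definition ghom U W : gvect K :=
  @Gvect K (ghom_type U W) (@ghom_pr U W) (@ghom_pr_linear U W)
    (@ghom_pr_proj U W) (@ghom_pr_sum U W).

Lemma ghom_degP U W d (f : ghom U W) : degree_map d (f : ghom_type U W) -> gdeg d f.
Proof.
move=> fd; have [fL _] := ghomP f; apply/eqP/ghom_ext => x; apply: gprP => k /=.
by rewrite gpr_gcomponent // (gpr_degree_map fL fd) gpr_proj eqxx -(gpr_degree_map fL fd).
Qed.

Lemma ghom_deg U W d (f : ghom U W) : gdeg d f -> degree_map d (f : ghom_type U W).
Proof.
by move=> /eqP <-; apply: gcomponent_degree; case: (ghomP f).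
Qed.

Fact gprod_linear V W i : linear (fun x : V * W => (gpr i x.1, gpr i x.2)).
Proof. by move=> a [x y] [z t]; rewrite /= !gprD !gprZ. Qed.

Fact gprod_proj V W i j (x : V * W) :
  (gpr i (gpr j x.1, gpr j x.2).1, gpr i (gpr j x.1, gpr j x.2).2) =
  if i == j then (gpr j x.1, gpr j x.2) else 0.
Proof. by rewrite /= !gpr_proj; case: eqP. Qed.

Lemma gpr_sum_sub V (x : V) s : uniq s -> {subset gsupp x <= s} ->
  \sum_(i <- s) gpr i x = x.
Proof.
move=> us sub; apply: gprP => i.
under eq_bigr do rewrite -[gpr _ _]scale1r.
rewrite gpr_big // scale1r; case: ifP => // /negP ns.
by rewrite gpr_notin //; apply/negP => /sub.
Qed.

Fact gprod_sum V W (x : V * W) : exists s : seq int,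
  uniq s && (x == \sum_(i <- s) (gpr i x.1, gpr i x.2)).
Proof.
exists (undup (gsupp x.1 ++ gsupp x.2)); rewrite undup_uniq /=.
set s := undup _.
have e : \sum_(i <- s) (gpr i x.1, gpr i x.2) =
    (\sum_(i <- s) gpr i x.1, \sum_(i <- s) gpr i x.2).
  by elim: (s) => [|i t IHt]; rewrite ?big_nil // !big_cons IHt.
rewrite e !gpr_sum_sub ?undup_uniq //; first by case: (x).
  by move=> i ix; rewrite mem_undup mem_cat ix orbT.
by move=> i ix; rewrite mem_undup mem_cat ix.
Qed.

Definition gprod V W : gvect K :=
  @Gvect K (V * W)%type _ (@gprod_linear V W) (@gprod_proj V W) (@gprod_sum V W).

Lemma gprod_deg V W i (x : gprod V W) : gdeg i x = gdeg i x.1 && gdeg i x.2.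
Proof. by case: x. Qed.

End GradedHom.

(** Freezing all letters but the first in a homogeneous multilinear map gives a
    graded map: expand each frozen letter into its homogeneous components. *)
Lemma graded_map_head (K : fieldType) (V W : gvect K) d (phi : seq V -> W) :
  multilin phi -> homog d phi -> forall s, graded_map (fun x => phi (x :: s)).
Proof.
move=> phiL phiH.
suff H r : forall ds l, all2 (@gdeg K V) ds l ->
    graded_map (fun x => phi (x :: l ++ r)).
  by move=> s; apply: (H s [::] [::]).
elim: r => [|y r IHr] ds l dl.
  apply: (@degree_map_graded _ _ _ (\sum_(j <- ds) j + d)).
    exact: (phiL [::]).
  move=> i x xi; rewrite cats0; have := phiH (i :: ds) (x :: l).
  by rewrite /= xi dl big_cons addrA; apply.
have [_ yE] := gsuppP y.
rewrite (_ : (fun x => _) =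
  fun x => \sum_(i <- gsupp y) phi (x :: rcons l (gpr i y) ++ r)).
  apply: graded_map_sum => i; apply: (IHr (rcons ds i)).
  elim: ds l {IHr} dl => [|j ds IHds] [|z l] //=; first by rewrite gdeg_gpr.
  by case/andP=> -> /IHds.
apply/funext => x; rewrite {1}yE (lin_sum (phiL (x :: l) r)).
by apply: eq_bigr => i _; rewrite cat_rcons.
Qed.

Lemma graded_map_head_mod (K : fieldType) (V M W : gvect K) d (phi : seq V -> M -> W) :
  multilin_mod phi -> homog_mod d phi ->
  forall s m, graded_map (fun x => phi (x :: s) m).
Proof.
move=> [phi1 phi2] phiH s m; have [_ mE] := gsuppP m.
rewrite (_ : (fun x => _) = fun x => \sum_(i <- gsupp m) phi (x :: s) (gpr i m)).
  apply: graded_map_sum => i.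
  apply: (@graded_map_head _ _ _ (i + d) (phi^~ (gpr i m))) => // ds t dst.
  by rewrite addrA; apply: phiH => //; apply: gdeg_gpr.
by apply/funext => x; rewrite {1}mE (lin_sum (phi1 _)).
Qed.

(** * The universal ghost into a module *)

Section Cofree.
Variables (K : fieldType) (A : ainfAlg K).
Notation sA := (gshift A).
Notation mu := (@amu K A).

Variable N : ainfMod A.

(** The homotopy fibre of N -> Hom(A, N).  Here Hom(A, N) is the left module on
    which A acts through right multiplication on the source; writing its source
    as sA absorbs the shift of the fibre. *)
Definition cover_space : gvect K := gprod N (ghom sA N).

Definition cover_ev (b : sA) (x : cover_space) : N := (x.2 : ghom_type sA N) b.

(** The Hom component of the action of a word t on a pair (n, phi), evaluated at
    b, has three parts: the map N -> Hom(A, N) sends n to b |-> mu_N(b t, n);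
    the action on Hom(A, N) sends phi to b |-> - phi(mu(b t)); and the
    differential of N acts on the value of phi.  The sign on b comes from moving
    the degree 1 action past b. *)
Definition cover_head (b : sA) (t : seq sA) (x : cover_space) : N :=
  mmu (koszul 1 b :: t) x.1.

Definition cover_free (b : sA) (t : seq sA) (x : cover_space) : N :=
  cover_ev (amu (koszul 1 b :: t)) x.

Definition cover_diff (b : sA) (t : seq sA) (x : cover_space) : N :=
  if t is [::] then mmu [::] (cover_ev (koszul 1 b) x) else 0.

Definition cover_act (t : seq sA) (x : cover_space) (b : sA) : N :=
  cover_head b t x - cover_free b t x + cover_diff b t x.

Fact cover_act_graded t x : graded_map (cover_act t x).
Proof.
have kG := koszul_graded sA 1.
have mG := graded_map_head_mod (@mmu_lin K A N) (@mmu_deg K A N).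
have aG := graded_map_head (@amu_lin K A) (@amu_deg K A).
have xG : graded_map (fun b => cover_ev b x) := ghomP x.2.
apply: graded_mapD; first apply: graded_mapD.
- exact: graded_map_comp kG (mG t x.1).
- by apply: graded_mapN; apply: graded_map_comp xG; apply: graded_map_comp kG (aG t).
case: t => [|y t]; last exact: graded_map0.
apply: graded_map_comp (graded_map_comp kG xG) _.
apply: (degree_map_graded (d := 1)); first exact: (mmu_lin N).1.
exact: mmu_nil_deg.
Qed.

Definition cover_mu (t : seq sA) (x : cover_space) : cover_space :=
  (mmu t x.1, ghom_of (cover_act_graded t x)).

Lemma cover_evE b t x : cover_ev b (cover_mu t x) = cover_act t x b.
Proof. by []. Qed.

Lemma cover_ev_lin b : linear (cover_ev b).
Proof. by []. Qed.

Lemma cover_ev_lin2 x : linear (fun b => cover_ev b x).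
Proof. exact: (ghomP x.2).1. Qed.

Lemma cover_ext (x y : cover_space) :
  x.1 = y.1 -> (forall b, cover_ev b x = cover_ev b y) -> x = y.
Proof. by case: x y => [n f] [n' f'] /= -> e; congr (_, _); apply: ghom_ext. Qed.

Lemma cover_head_lin b : multilin_mod (cover_head b).
Proof.
have [N1 N2] := mmu_lin N.
by split=> [t a x y|x l r]; [apply: N1 | apply: (N2 _ (_ :: l))].
Qed.

Lemma cover_free_lin b : multilin_mod (cover_free b).
Proof.
split=> [t a x y|x l r a y z]; first exact: cover_ev_lin.
by rewrite /cover_free -!cat_cons amu_lin cover_ev_lin2.
Qed.

Lemma cover_diff_lin b : multilin_mod (cover_diff b).
Proof.
split=> [[|t0 t] a x y|x [|l0 l] r a y z] /=; rewrite ?scaler0 ?addr0 //.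
by rewrite /cover_diff cover_ev_lin (mmu_lin N).1.
Qed.

Lemma cover_lin : multilin_mod cover_mu.
Proof.
have combine (a : K) (x x' y y' z z' : N) :
    (a *: x + x') - (a *: y + y') + (a *: z + z') = a *: (x - y + z) + (x' - y' + z').
  by rewrite opprD [X in X + _]addrACA -scalerN -scalerDr addrACA -scalerDr.
split=> [t a x y | x l r a y z]; apply: cover_ext => [|b].
- exact: (mmu_lin N).1.
- rewrite cover_ev_lin !cover_evE /cover_act (cover_head_lin b).1.
  by rewrite (cover_free_lin b).1 (cover_diff_lin b).1 combine.
- exact: (mmu_lin N).2.
rewrite cover_ev_lin !cover_evE /cover_act (cover_head_lin b).2.
by rewrite (cover_free_lin b).2 (cover_diff_lin b).2 combine.
Qed.

Lemma cover_deg : homog_mod 1 cover_mu.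
Proof.
move=> ds s i x dss; rewrite gprod_deg => /andP[x1 x2].
have xd : degree_map i (fun b => cover_ev b x) := ghom_deg x2.
rewrite gprod_deg (mmu_deg dss x1) /=; apply: ghom_degP => j b bj.
have kj : gdeg j (koszul 1 b) by rewrite (koszul_gdeg _ bj) gdegZ.
have dbs : all2 (@gdeg K sA) (j :: ds) (koszul 1 b :: s) by rewrite /= kj.
have H1 : gdeg (j + (\sum_(j <- ds) j + i + 1)) (cover_head b s x).
  by have := mmu_deg dbs x1; rewrite big_cons; congr gdeg; ring.
have H2 : gdeg (j + (\sum_(j <- ds) j + i + 1)) (cover_free b s x).
  by have := xd _ _ (amu_deg dbs); rewrite big_cons; congr gdeg; ring.
have H3 : gdeg (j + (\sum_(j <- ds) j + i + 1)) (cover_diff b s x).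
  case: s ds dss {dbs H1 H2} => [|y s] [|k ds] //= _; rewrite /gdeg ?gpr0 //.
  have := mmu_nil_deg (xd _ _ kj); rewrite big_nil /gdeg.
  by congr (gpr _ _ == _); ring.
change (gdeg (j + (\sum_(j <- ds) j + i + 1)) (cover_act s x b)).
by rewrite /cover_act /gdeg !gprD gprN (eqP H1) (eqP H2) (eqP H3).
Qed.

(** On the N component these are the relations of N.  Evaluated at b, the terms
    in n are the relations of N at the word b s, the terms in phi those of A at
    the word b s; what is left is b_N^2 = 0 on phi(b) and terms which cancel. *)
Lemma cover_mod_pull s x : mod_pull mu cover_mu cover_mu s x = 0.
Proof.
have fst_lin : linear (fun y : cover_space => y.1) by [].
apply: cover_ext => [|b].
  rewrite (mod_pull_comp _ _ _ _ fst_lin); exact: (mmu_mod_pull s x.1).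
rewrite (mod_pull_comp _ _ _ _ (cover_ev_lin b)).
have [N1 N2] := mmu_lin N; have eL := cover_ev_lin2 x.
set c := koszul 1 b.
have cb : koszul 1 c = b by rewrite koszulK.
have kmu t : koszul 1 (amu (c :: kmap 1 t)) = - amu (b :: t) :> sA.
  rewrite (koszul_homog 1 _ (@amu_lin K A) (@amu_deg K A)) mulr1 expr1z scaleN1r.
  by rewrite /= cb -/(kmap 1 (kmap 1 t)) kmapK.
have -> : mod_pull mu cover_mu (fun t y => cover_ev b (cover_mu t y)) s x =
    mod_pull mu cover_mu (cover_head b) s x
    - mod_pull mu cover_mu (cover_free b) s x
    + mod_pull mu cover_mu (cover_diff b) s x.
  by rewrite -mod_pullN -!mod_pullD.
(* q, a2 and p1 are the sums which occur in several of the three parts below *)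
pose q : N := mmu [::] (cover_ev (amu (b :: s)) x).
pose a2 : N := cut (fun u v => mmu (amu (b :: u) :: v) x.1) s.
have H1 : mod_pull mu cover_mu (cover_head b) s x = - mmu [::] (mmu (b :: s) x.1) - a2.
  have := mod_pull_cons (@mmu K A N) b s x.1 (mmu_lin N).
  by rewrite mmu_mod_pull => /esym/eqP; rewrite addrC addr_eq0 opprD => /eqP.
pose p1 : N := cut (fun l r => cover_ev (amu (amu (b :: l) :: r)) x) s.
have H2 : mod_pull mu cover_mu (cover_free b) s x = - a2 - q.
  rewrite /mod_pull convE.
  have -> : cut (fun l r => cover_free b (kmap 1 l) (cover_mu r x)) s = - a2 + p1 - q.
    have -> : q = cut (fun l r =>
        if r is [::] then mmu [::] (cover_ev (amu (b :: l)) x) else 0) s.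
      by rewrite cut_last // => l [].
    rewrite -!cutN -!cutD; apply: eq_cut => l r _.
    rewrite /cover_free cover_evE /cover_act /cover_head /cover_free /cover_diff.
    rewrite -/c kmu.
    have /= -> := linN (N2 x.1 [::] r); have /= -> := linN (@amu_lin K A [::] r).
    rewrite (linN eL) opprK; congr (_ + _).
    by case: r => [|? ?]; rewrite ?oppr0 // (linN eL) (linN (N1 _)).
  have := bar_pull_cons b s (@amu_lin K A); rewrite amu_bar_pull.
  move/(congr1 (fun y => cover_ev y x)); rewrite (lin0 eL) (linD eL) (cut_lin _ _ eL).
  rewrite bar_pullE (cut_lin _ _ eL) -/p1 => /esym/eqP; rewrite addr_eq0 => /eqP ->.
  rewrite bar_pullE.
  have -> : cut (fun l r => cut (fun u v =>
      cover_free b (kmap 1 l ++ amu u :: v) x) r) s =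
    cut (fun l r => cover_ev (cut (fun u v => amu (c :: kmap 1 l ++ amu u :: v)) r) x) s.
    by apply: eq_cut => l r _; rewrite (cut_lin _ _ eL).
  by rewrite addrAC addrNK.
have H3 : mod_pull mu cover_mu (cover_diff b) s x = mmu [::] (mmu (b :: s) x.1) - q.
  rewrite /mod_pull bar_pullE [X in _ + X]cut0 ?addr0; last first.
    by move=> l r _; rewrite cut0 // => u v _; case: (kmap 1 l).
  have -> : conv 1 (cover_diff b) cover_mu s x = cover_diff b [::] (cover_mu s x).
    by rewrite convE cut_first.
  rewrite /cover_diff cover_evE /cover_act /cover_head /cover_free cb.
  rewrite (linD (N1 _)) (linD (N1 _)) (linN (N1 _)).
  rewrite [X in _ + X](_ : _ = 0) ?addr0 //.
  rewrite /cover_diff; case: (s) => [|? ?]; last exact: (lin0 (N1 _)).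
  rewrite cb; have := mmu_mod_pull [::] (cover_ev b x); rewrite mod_pull_nil //.
rewrite H1 H2 H3 (lin0 (cover_ev_lin _)) opprD !opprK.
by rewrite [X in X + _]addrA subrK addrACA addNr subrr addr0.
Qed.

End Cofree.

Section Cover.
Variables (K : fieldType) (A : ainfAlg K) (N : ainfMod A).
Notation sA := (gshift A).
Notation mu := (@amu K A).

Lemma cover_sq (W : lmodType K) (phi : seq sA -> cover_space N -> W) :
  multilin_mod phi ->
  forall s x, mod_pull mu (@cover_mu K A N) (mod_pull mu (@cover_mu K A N) phi) s x = 0.
Proof.
move=> phiL s x; rewrite mod_pull_sq //.
by rewrite convE cut0 // => l r _; rewrite cover_mod_pull (lin0 (phiL.1 _)).
Qed.

Lemma cover_unitl (x : cover_space N) : cover_mu [:: aunit A] x = x.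
Proof.
apply: cover_ext => [|b]; first exact: mmu_unitl.
rewrite cover_evE /cover_act addr0 /cover_head (mmu_unit (l := [:: _]) (r := [::])) //.
rewrite sub0r /cover_free amu_unitr (linN (cover_ev_lin2 x)) opprK.
by rewrite koszulK.
Qed.

Lemma cover_unit l r (x : cover_space N) : size (l ++ r) != 0%N ->
  cover_mu (l ++ aunit A :: r) x = 0.
Proof.
move=> lr; apply: cover_ext => [|b]; first exact: mmu_unit.
rewrite cover_evE /cover_act /cover_head /cover_free -!cat_cons.
rewrite mmu_unit // amu_unit // (lin0 (cover_ev_lin2 x)) subrr.
by rewrite (lin0 (cover_ev_lin b)); case: (l) => [|? ?]; rewrite addr0.
Qed.

Definition ghost_cover : ainfMod A :=
  AinfMod (@cover_lin K A N) (@cover_deg K A N) cover_sq cover_unitl cover_unit.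

Definition cover_proj : cochain ghost_cover N :=
  strict (fun x : ghost_cover => (x : cover_space N).1).

Lemma cover_proj_cocycle : cocycle 0 cover_proj.
Proof.
split=> [|s m].
  apply: strict_is_hom => // i x xi; rewrite addr0.
  by have /andP[] := etrans (esym (gprod_deg i (x : cover_space N))) xi.
by rewrite hom_diff_strict expr0z scale1r kmap_id subrr.
Qed.

(** The map (n, phi) |-> - phi(1) is a null-homotopy of the linear part of the
    projection, because - phi(1) has boundary n up to terms in the differential
    of (n, phi); so the projection lies in F^1. *)
Lemma cover_proj_ghost : ghost 0 cover_proj.
Proof.
apply: filtration1_ghost.
pose h (x : ghost_cover) : N := - cover_ev (aunit A) (x : cover_space N).
have hL : linear h.
  by move=> a x y; rewrite /h cover_ev_lin opprD scalerN.
have hd : degree_map (-1) h.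
  move=> i x xi; rewrite /gdeg gprN; apply/eqP; congr (- _); apply/eqP.
  have /andP[_ x2] := etrans (esym (gprod_deg i (x : cover_space N))) xi.
  by have := ghom_deg x2 (aunit_deg A); rewrite addrC.
have kc := strict_boundary_cocycle hL hd.
split; first exact: cover_proj_cocycle.
exists (fun s m => (-1) *: hom_diff (-1) (strict h) s m + cover_proj s m); split.
- exact: (cocycle_lin (-1) kc cover_proj_cocycle).
- case=> // x _; rewrite hom_diff_strict scaleN1r exprN1 invrN1 scaleN1r opprK.
  have [N1 N2] := mmu_lin N; have eL := cover_ev_lin2 (x : cover_space N).
  rewrite /h cover_evE /cover_act /cover_head /cover_free /cover_diff.
  have -> : koszul 1 (aunit A) = - aunit A.
    by rewrite (koszul_gdeg _ (aunit_deg A)) mul1r exprN1 invrN1 scaleN1r.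
  have /= -> := linN (N2 (x : cover_space N).1 [::] [::]).
  have /= -> := linN (@amu_lin K A [::] [::]).
  rewrite mmu_unitl (amu_unit (l := [::]) (r := [::])) // oppr0 (lin0 eL) subr0.
  by rewrite (linN eL) opprD opprK addrK addNr.
exists (strict h); first exact: strict_is_hom.
by move=> s m; rewrite scaleN1r opprD opprK addrCA subrr addr0.
Qed.

(** The strict factorisation of a cocycle through the projection. *)
Section Lift.
Variables (M : ainfMod A) (d : int) (f : cochain M N).
Hypothesis fc : cocycle d f.

Fact lift_graded s m : graded_map (fun b => f (koszul d b :: s) m).
Proof.
have [[fL fH _] _] := fc.
exact: graded_map_comp (koszul_graded sA d) (graded_map_head_mod fL fH s m).
Qed.

Definition cover_lift : cochain M ghost_cover :=
  fun s m => (f s m, ghom_of (lift_graded s m)) : cover_space N.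

Lemma cover_lift_ev b s m :
  cover_ev b (cover_lift s m : cover_space N) = f (koszul d b :: s) m.
Proof. by []. Qed.

Lemma cover_proj_lift s m : hom_comp d cover_proj cover_lift s m = f s m.
Proof. exact: strict_conv. Qed.

Lemma cover_lift_hom : is_hom d cover_lift.
Proof.
have [[[f1 f2] fH fU] _] := fc; split=> [|ds s i m dss im|l t m].
- split=> [s a x y|m l r a x y]; apply: (@cover_ext K A N) => [|b].
  + exact: f1.
  + by rewrite (cover_ev_lin b) !cover_lift_ev f1.
  + exact: f2.
  by rewrite (cover_ev_lin b) !cover_lift_ev (f2 m (koszul d b :: l)).
- change (@gdeg K (cover_space N) (\sum_(j <- ds) j + i + d) (cover_lift s m)).
  rewrite gprod_deg (fH _ _ _ _ dss im) /=; apply: ghom_degP => j b bj.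
  have kj : gdeg j (koszul d b) by rewrite (koszul_gdeg _ bj) gdegZ.
  have := fH (j :: ds) (koszul d b :: s) i m; rewrite /= kj dss big_cons.
  by move=> /(_ isT im); congr gdeg; ring.
apply: (@cover_ext K A N) => [|b]; first exact: fU.
by rewrite cover_lift_ev (fU (_ :: l)) (lin0 (cover_ev_lin b)).
Qed.

(** Evaluated at b, the differential of the lift is, up to the sign of b, the
    differential of f at the word b s, apart from the term f_0(mu_M(b s, m)), which vanishes by
    hypothesis. *)
Lemma cover_lift_cocycle : (forall m, f [::] m = 0) -> cocycle d cover_lift.
Proof.
move=> f0; split=> [|s m]; first exact: cover_lift_hom.
have [[fL fH fU] fD] := fc; have [N1 N2] := mmu_lin N.
have fst_lin : linear (fun y : cover_space N => y.1) by [].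
apply: (@cover_ext K A N) => [|b].
  rewrite /hom_diff (linD fst_lin) (linN fst_lin) (linZ fst_lin).
  rewrite (mod_pull_comp _ _ _ _ fst_lin) convE (cut_lin _ _ fst_lin).
  exact: fD.
have eL := @cover_ev_lin K A N b.
rewrite /hom_diff (linD eL) (linN eL) (linZ eL) (mod_pull_comp _ _ _ _ eL).
rewrite (lin0 eL) convE (cut_lin _ _ eL).
(* c carries the sign of moving b past both the lift, of degree d, and the
   differential *)
pose c := koszul (d + 1) b.
have kc : koszul 1 c = koszul d b by rewrite koszulD addrC -addrA koszul_parity.
have dc : koszul d c = koszul 1 b by rewrite koszulD addrA addrC koszul_parity.
have := fD (c :: s) m.
rewrite /hom_diff mod_pull_cons // f0 add0r kc convE cut_cons /= dc.
move=> /eqP; rewrite subr_eq0 => /eqP E.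
have cd : koszul d (koszul 1 b) = c by rewrite -dc koszulK.
have -> : cut (fun l r => cover_ev b (cover_mu (kmap d l) (cover_lift r m))) s =
    cut (fun l r => mmu (koszul 1 b :: kmap d l) (f r m)) s
    - ((-1 : K) ^ d) *: cut (fun u v => f (amu (c :: u) :: v) m) s
    + mmu [::] (f (c :: s) m).
  have -> : mmu [::] (f (c :: s) m) =
      cut (fun l r => if l is [::] then mmu [::] (f (c :: r) m) else 0) s.
    by rewrite cut_first.
  rewrite cut_scale -cutN -!cutD; apply: eq_cut => l r _.
  rewrite cover_evE /cover_act; congr (_ - _ + _).
    rewrite /cover_free cover_lift_ev (koszul_homog d _ (@amu_lin K A) (@amu_deg K A)).
    rewrite mulr1 /= cd -/(kmap d (kmap d l)) kmapK.
    exact: (linZ (fL.2 m [::] r)).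
  by rewrite /cover_diff; case: l => //=; rewrite cover_lift_ev cd.
rewrite [_ - _ + _]addrAC scalerBr scalerA sqr_sign scale1r [X in _ *: X]addrC.
by rewrite -E opprB addrA [X in X - _]addrC subrr.
Qed.

End Lift.

End Cover.

(** * Ghost powers and the length filtration *)

Section Main.
Variables (K : fieldType) (A : ainfAlg K).
Implicit Types (L M N : ainfMod A) (d e : int) (r : nat).

(** Compositions of ghosts are built by adding ghosts on the right; associativity
    allows them to be added on the left. *)
Lemma ghost_comp_compl r L M N d e (f : cochain M N) (g : cochain L M) :
  ghost e f -> ghost_comp r d g -> ghost_comp r.+1 (e + d) (hom_comp d f g).
Proof.
move=> gf gg.
elim: gg N f gf => {r L M d g} [L M d g gg|r L' L M d d' g g' gg IH gg'] N f gf.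
  by apply: GhostComp => //; apply: GhostOne.
have [[[[fL _] _ _] _] _] := gf.
have -> : hom_comp (d + d') f (hom_comp d' g g') = hom_comp d' (hom_comp d f g) g'.
  by apply: cochain_ext => s m; apply: conv_assoc.
by rewrite addrA; apply: GhostComp => //; apply: IH.
Qed.

(** By induction: the lift of f through the universal ghost into N is one step
    lower in the filtration, since it reads one more letter of f. *)
Lemma filtration_ghost_comp r M N d (f : cochain M N) :
  cocycle d f -> (forall s m, (size s < r.+1)%N -> f s m = 0) ->
  ghost_comp r.+1 d f.
Proof.
elim: r N f => [|r IHr] N f fc f0.
  apply: GhostOne; apply: filtration1_ghost; split=> //; exists f; split=> //.
  have := coboundary0 M N d; congr coboundary.
  by apply: cochain_ext => s m; rewrite subrr.
have fc' : cocycle d (cover_lift fc) by apply: cover_lift_cocycle => m; apply: f0.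
have -> : f = hom_comp d (@cover_proj K A N) (cover_lift fc).
  by apply: cochain_ext => s m; rewrite cover_proj_lift.
rewrite -[d in ghost_comp _ d]add0r; apply: ghost_comp_compl.
  exact: cover_proj_ghost.
apply: IHr => // s m sr; apply: (@cover_ext K A N) => [|b].
  by apply: f0; apply: ltnW.
by rewrite cover_lift_ev f0 // (lin0 (cover_ev_lin b)).
Qed.

End Main.

Theorem theorem3p12 (K : fieldType) (A : ainfAlg K) (r : nat) (hr : (1 <= r)%N)
    (M N : ainfMod A) (d : int) (f : cochain M N) :
  ghost_power r d f <-> in_filtration r d f.
Proof.
split=> [[cf [k [g [gg fg]]]]|[cf [f' [cf' f'0 ff']]]].
  apply: in_filtration_cohom cf fg _; apply: in_filtration_sum => i.
  exact: ghost_comp_filtration.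
split=> //; exists 1%N, (fun _ => f'); split=> [_|].
  by case: r hr f'0 => // r _; apply: filtration_ghost_comp.
by rewrite (_ : (fun s m => _) = f') //; apply: cochain_ext => s m; rewrite big_ord1.
Qed.
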